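(* In Case B ($t_N=t^m$, $m\in\mathbb N_+$), for all $\alpha\le\beta$ in $\mathcal P_N=\{1,2\}^N$, $$Q^{B,I,+}_{\alpha,\beta}=R^B_{\alpha,\beta}.$$
   Context: Order: $\alpha\le\beta$ iff every prefix of $\alpha$ contains at least as many $1$'s as the prefix of $\beta$ of the same length. $\|\alpha\|$ is the length of a string and $\|\alpha\|_\sigma$ the number of letters $\sigma$ in it. Generating function $Q^{B,I,+}$. A string $\alpha$ is identified with the lattice path from $(0,0)$ whose $i$-th step is $(1,1)$ if $\alpha_i=1$ and $(1,-1)$ if $\alpha_i=2$; $\alpha\le\beta$ iff path $\alpha$ is weakly above path $\beta$. A box $(i,j)$ is the 45-degree rotated square centred at $(i,j)$ with vertices $(i\pm1,j),(i,j\pm1)$. $\lambda^+(\alpha)$ is the set of boxes $(i,j)$ with $0<i\le N$, $|j|\le i$, $i+j-1$ even, above the path $\alpha$. The region for $\alpha\le\beta$ is $\lambda^+(\beta)/\lambda^+(\alpha)$; its boxes $(N,j)$ are anchor boxes. The box just below $(x,y)$ is $(x,y-2)$. A ballot path of length $(l,l')\in\mathbb N^2$ is a path with steps $(1,\pm1)$ from some $(x,y)$ to $(x+2l+l',y+l')$ staying weakly above height $y$; a ballot strip of length $(l,l')$ is the set of boxes centred at its vertices. $\mathrm{Conf}^{I}(\alpha,\beta)$ is the set of partitions of the boxes of the region into ballot strips such that: (Rule 0) the rightmost box of a strip with $l'\ge1$ is an anchor box; (Rule Ia) for strips $\mathcal D,\mathcal D'$, if some box of $\mathcal D$ is just below a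 box of $\mathcal D'$, then all boxes just below a box of $\mathcal D'$ belong to $\mathcal D$; (Rule Ib) for each $(l,l')$ with $l'\ge m$, the number of strips of length $(l,l')$ is even if $l'-m$ is even, and zero otherwise. A strip of length $(l,l')$ has weight $t^{2l+2l'}$ if $0\le l'\le m-1$, $t^{m+l'+2l}$ if $l'\ge m$ and $l'-m$ even, $t^{m+l'+2l-1}$ if $l'\ge m$ and $l'-m$ odd. $Q^{B,I,+}_{\alpha,\beta}$ is the sum over $\mathrm{Conf}^I(\alpha,\beta)$ of the product of the weights of the strips ($Q^{B,I,+}_{\alpha,\alpha}=1$). Binary tree. Let $\mathcal Z$ be the smallest set of strings containing $\emptyset$, closed under concatenation and under $z\mapsto1z2$. Any string is a concatenation of elements of $\mathcal Z$ with unpaired $2$'s followed by unpaired $1$'s (i.e. $1$ and $2$ are matched as opening and closing parentheses). Number the unpaired $1$'s from the right. For $1\le j\le m$, the $(m+1-j)$-th one is called $j$-terminal. For each $j\ge m+1$ with $j-m$ odd such that a $(j+1)$-th unpaired $1$ exists, the $j$-th and $(j+1)$-th unpaired $1$'s form a $11$-pair. An unpaired $1$ not classified so far (there is at most one) is an extra-unpair $1$. The rooted tree $A(\alpha)$ is defined recursively: $A(\emptyset)$ is the empty tree; $A(2w)=A(w)$ (unpaired $2$); $A(zw)$ for $z\in\mathcal Z$ is obtained by attaching $A(z)$ and $A(w)$ at their roots; $A(1z2)$, $z\in\mathcal Z$, is obtained by attaching an edge just above (the root of) $A(z)$; if the first $1$ of $1w$ is $j$-terminal, $A(1w)$ is obtained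 by putting an edge just above $A(w)$, this edge being marked ''$+$'' only when $j=1$; if the two displayed $1$'s of $1z1w$ ($z\in\mathcal Z$) form a $11$-pair, $A(1z1w)$ is obtained by attaching an edge, marked ''$+$'', above the root of $A(zw)$; if the first $1$ of $1w$ is an extra-unpair $1$, $A(1w)=A(w)$. Leaves of $A(\beta)$ correspond to adjacent pairs $12$ in $\beta$ and to the last letter of $\beta$ if it is a $1$. Precedence of edges. Suppose $w=w'z_{m+2r}w''$ with $w''=1z_{m+2r-1}1\cdots z_11z_0$ (containing exactly $m+2r$ displayed $1$'s), $z_i\in\mathcal Z$, $r\ge0$, and $z_{m+2r}$ non-empty and maximal. Write $z_{m+2r}=x_sx_{s-1}\cdots x_1$ with each $x_i\in\mathcal Z$ non-empty and not a product of two non-empty elements of $\mathcal Z$. Each of $A(x_i)$ and $A(w'')$ has a unique maximal edge (the edge connected to its root). In $A(w)$, the maximal edge of $A(w'')$ immediately precedes that of $A(x_1)$, and the maximal edge of $A(x_i)$ immediately precedes that of $A(x_{i+1})$ for $1\le i\le s-1$. This is done for every such $r$. An edge precedes another if they are linked by a chain of immediate precedences. Capacities. Let $\alpha\le\beta$ have the same length. If $\beta=\beta'12\beta''$ and $\alpha=\alpha'vw\alpha''$ with $\|\alpha'\|=\|\beta'\|$, $v,w\in\{1,2\}$, the leaf edge of this $12$ has capacity $\|\alpha'v\|_1-\|\beta'1\|_1$. If $\beta$ ends with $1$, the corresponding leaf edge has capacity $\|\alpha\|_1-\|\beta\|_1$. $A(\beta/\alpha)$ is $A(\beta)$ equipped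 with these capacities. A labelling of $A(\beta/\alpha)$ assigns a non-negative integer to each edge such that: (1) the integer on an edge connected to a leaf is at most its capacity; (2) integers are non-increasing along paths from leaves to the root; (3) the integer on an edge marked ''$+$'' is even; (4) if an edge has preceding edges and its label is less than or equal to the labels on all of its preceding edges, then its label is even. $R^B_{\alpha,\beta}=\sum_\nu t^{2|\nu|}$, summed over all labellings $\nu$ of $A(\beta/\alpha)$, where $|\nu|$ is the sum of the labels on all edges. *)

(* Defs.v *)
From HB Require Import structures.
From mathcomp Require Import all_boot all_order all_algebra.
From mathcomp Require Import finmap.
From mathcomp Require Import zify.

Set Implicit Arguments.
Unset Strict Implicit.
Unset Printing Implicit Defensive.

Import Order.TTheory GRing.Theory Num.Theory.

Local Open Scope fset_scope.
Local Open Scope nat_scope.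

(* Strings over {1,2} are boolean sequences: [true] is the letter 1 and       *)
(* [false] is the letter 2.                                                   *)

Definition ones (w : seq bool) : nat := count_mem true w.
Definition twos (w : seq bool) : nat := count_mem false w.

Definition string_le (a b : seq bool) : Prop :=
  forall k, ones (take k b) <= ones (take k a).

(* Height at abscissa [i] of the lattice path of [w]. *)
Definition height (w : seq bool) (i : nat) : int :=
  ((ones (take i w))%:Z - (twos (take i w))%:Z)%R.

Definition box : Type := (nat * int)%type.

(* A box lies above the path iff its lowest vertex [(i, j - 1)] lies weakly   *)
(* above the path; its other vertices then do too, as steps have slope +-1.   *)
Definition lambda_cond (w : seq bool) (u : box) : bool :=
  [&& (`|u.2| <= u.1%:Z)%R, (2 %| (u.1%:Z + u.2 - 1)%R)%Z
    & (height w u.1 <= u.2 - 1)%R].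

Definition lambda_plus (w : seq bool) : {fset box} :=
  [fset u in [seq (i, (j%:Z - (size w)%:Z)%R)
             | i <- iota 1 (size w), j <- iota 0 (size w).*2.+1]
  | lambda_cond w u].

Lemma in_lambda_plus (w : seq bool) (u : box) :
  (u \in lambda_plus w) = (0 < u.1 <= size w) && lambda_cond w u.
Proof.
case: u => i j; rewrite /lambda_plus; set s := [seq _ | _ <- _, _ <- _].
rewrite inE -[X in X = _]/(((i, j) \in s) && lambda_cond w (i, j)).
have [/and3P[/= le_j _ _]|] := boolP (lambda_cond w (i, j)); last first.
  by rewrite !andbF.
rewrite !andbT; apply/allpairsP/idP => [[[i' j'] [+ _ [-> _]]]|lt_i].
  by rewrite mem_iota /=; lia.
exists (i, `|(j + (size w)%:Z)%R|%N); split.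
- by rewrite mem_iota /=; lia.
- by rewrite mem_iota /=; lia.
- by congr pair => /=; lia.
Qed.

Definition region (a b : seq bool) : {fset box} :=
  lambda_plus b `\` lambda_plus a.

Definition just_below (u v : box) : bool := u == (v.1, (v.2 - 2)%R).

Definition step (u v : box) : bool :=
  (v.1 == u.1.+1) && ((v.2 == u.2 + 1)%R || (v.2 == u.2 - 1)%R).

(* [u :: p] is the sequence of vertices of a ballot path of length [(l, l')]. *)
Definition ballot_path (l l' : nat) (u : box) (p : seq box) : bool :=
  [&& path step u p, last u p == (u.1 + l.*2 + l', (u.2 + l'%:Z)%R)
    & all (fun v : box => (u.2 <= v.2)%R) p].

Definition ballot_strip (R : {fset box}) (l l' : nat) (D : {set R}) : bool :=
  [exists u : R, exists p : (l.*2 + l').-tuple R,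
    ballot_path l l' (val u) (map val p) && (D == [set v in u :: p])].

(* A strip of length [(l, l')] has [2 l + l' + 1] boxes, so both components   *)
(* are smaller than the number of boxes of the region.                        *)
Definition len_bound (R : {fset box}) : finType :=
  ('I_(#|` R|) * 'I_(#|` R|))%type.

Definition strip_length (R : {fset box}) (D : {set R}) : nat * nat :=
  if [pick s : len_bound R | ballot_strip s.1 s.2 D] is Some s
  then (val s.1, val s.2) else (0, 0).

Definition rule0 (N : nat) (R : {fset box}) (P : {set {set R}}) : bool :=
  [forall D in P, (0 < (strip_length D).2) ==>
    [forall u in D, [forall v in D, (val v).1 <= (val u).1]
                      ==> ((val u).1 == N)]].

Definition ruleIa (R : {fset box}) (P : {set {set R}}) : bool :=
  [forall D in P, forall D' in P,
    [exists u in D, exists v in D', just_below (val u) (val v)] ==>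
    [forall v in D', exists u in D, just_below (val u) (val v)]].

Definition ruleIb (m : nat) (R : {fset box}) (P : {set {set R}}) : bool :=
  [forall s : len_bound R, (m <= s.2) ==>
    let n := #|[set D in P | ballot_strip s.1 s.2 D]| in
    if odd (s.2 - m) then n == 0 else ~~ odd n].

Definition conf_I (m N : nat) (R : {fset box}) (P : {set {set R}}) : bool :=
  [&& partition P [set: R],
      [forall D in P, exists s : len_bound R, ballot_strip s.1 s.2 D],
      rule0 N P, ruleIa P & ruleIb m P].

Definition weight_exp (m : nat) (s : nat * nat) : nat :=
  let: (l, l') := s in
  if l' < m then l.*2 + l'.*2
  else if ~~ odd (l' - m) then m + l' + l.*2
  else m + l' + l.*2 - 1.

(* The generating function Q^{B,I,+}; the variable t is ['X]. *)
Definition QBI (m : nat) (a b : seq bool) : {poly int} :=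
  (\sum_(P : {set {set region a b}} | conf_I m (size a) P)
     \prod_(D in P) 'X^(weight_exp m (strip_length D)))%R.

Inductive Zword : seq bool -> Prop :=
| Znil : Zword [::]
| Zcat u v of Zword u & Zword v : Zword (u ++ v)
| Zwrap u of Zword u : Zword (true :: rcons u false).

Definition inZ (z : seq bool) : bool :=
  (ones z == twos z)
  && all (fun k => twos (take k z) <= ones (take k z)) (iota 0 (size z).+1).

Lemma inZ_prefix (z : seq bool) k :
  inZ z -> twos (take k z) <= ones (take k z).
Proof.
case/andP=> /eqP e /allP h; case: (leqP k (size z)) => hk.
  by apply: h; rewrite mem_iota add0n ltnS.
by rewrite take_oversize ?e // ltnW.
Qed.

Lemma inZ_intro (z : seq bool) :
  ones z = twos z -> (forall k, twos (take k z) <= ones (take k z)) -> inZ z.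
Proof. by move=> e h; rewrite /inZ e eqxx; apply/allP => k _; apply: h. Qed.

Lemma inZP (z : seq bool) : reflect (Zword z) (inZ z).
Proof.
apply: (iffP idP); last first.
  elim=> [|u v _ Zu _ Zv|u _ Zu]; first by [].
  - apply: inZ_intro => [|k].
      case/andP: Zu Zv => /eqP eu _ /andP[/eqP ev _].
      by move: eu ev; rewrite /ones /twos !count_cat => -> ->.
    rewrite take_cat; case: ltnP => _; first exact: inZ_prefix.
    have := inZ_prefix (k - size u) Zv; case/andP: Zu => /eqP + _.
    by rewrite /ones /twos !count_cat; lia.
  - have /andP[/eqP eu _] := Zu.
    apply: inZ_intro => [|k].
      by move: eu; rewrite /ones /twos /= -cats1 !count_cat /=; lia.
    case: k => [|k] //=; rewrite -cats1 take_cat; case: ltnP => hk.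
      by have := inZ_prefix k Zu; rewrite /ones /twos /=; lia.
    move: eu; rewrite /ones /twos /= !count_cat.
    by case: (k - size u) => [|j] /=; lia.
move: {2}(size z) (leqnn (size z)) => n.
elim: n z => [|n IH] z; first by rewrite leqn0 size_eq0 => /eqP -> _; exact: Znil.
case: z => [|c z] hn Zz; first by move=> *; exact: Znil.
case: c Zz hn => Zz hn; last by have := inZ_prefix 1 Zz; rewrite /= take0.
pose P k := ones (take k.+1 (true :: z)) == twos (take k.+1 (true :: z)).
have exP : exists k, P k.
  by exists (size z); rewrite /P take_oversize //; case/andP: Zz.
case: (ex_minnP exP) => k Pk kmin.
have hk : k <= size z.
  by apply: kmin; rewrite /P take_oversize //; case/andP: Zz.
have k0 : 0 < k by case: (k) Pk; rewrite /P /= ?take0.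
have kz : k.-1 < size z by rewrite prednK.
have tk : take k z = rcons (take k.-1 z) (nth false z k.-1).
  by rewrite -take_nth // prednK.
have strict i : i < k -> twos (take i z) <= ones (take i z).
  move=> hi; have := inZ_prefix i.+1 Zz.
  have : ~~ P i by apply/negP => /kmin; rewrite leqNgt hi.
  by rewrite /P /ones /twos /=; lia.
have [Eu Eb] : ones (take k.-1 z) = twos (take k.-1 z)
               /\ nth false z k.-1 = false.
  have := strict k.-1; rewrite prednK // leqnn => /(_ isT).
  move: Pk; rewrite /P /ones /twos /= tk -cats1 !count_cat /=.
  by case: (nth _ _ _) => /=; lia.
have Zu : inZ (take k.-1 z).
  apply: inZ_intro => // j; case: (leqP j k.-1) => hj.
    by rewrite take_takel //; apply: strict; lia.
  by rewrite [take j _]take_oversize ?Eu //; rewrite size_takel; lia.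
have Zv : inZ (drop k z).
  have ek : ones (take k z) + 1 = twos (take k z).
    by move: Pk; rewrite /P /ones /twos /=; lia.
  apply: inZ_intro => [|j].
    case/andP: Zz => /eqP + _; rewrite -(cat_take_drop k z).
    move: ek; rewrite /ones /twos /= !count_cat drop_size_cat; last first.
      by rewrite size_takel.
    by lia.
  have := inZ_prefix (k + j).+1 Zz; move: ek.
  rewrite /= takeD /ones /twos /= !count_cat; lia.
rewrite -(cat_take_drop k z) tk Eb.
have -> : true :: rcons (take k.-1 z) false ++ drop k z =
          (true :: rcons (take k.-1 z) false) ++ drop k z by [].
apply: Zcat.
  by apply: Zwrap; apply: IH => //; rewrite size_takel; move: hn => /=; lia.
by apply: IH => //; rewrite size_drop; move: hn => /=; lia.
Qed.

(* The length of the longest prefix of [w] that belongs to Z. *)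
Definition zlen (w : seq bool) : nat :=
  last 0 [seq k <- iota 0 (size w).+1 | inZ (take k w)].

(* Whether a letter 1 followed by [w] is paired, i.e. [w = z2w'], z in Z. *)
Definition closes (w : seq bool) : bool :=
  if drop (zlen w) w is false :: _ then true else false.

(* The number of unpaired 1's of [w]; if [w] starts with an unpaired 1, this  *)
(* is also the number of that 1, counted from the right.                      *)
Fixpoint unpaired_ones (w : seq bool) : nat :=
  if w is c :: w' then (c && ~~ closes w') + unpaired_ones w' else 0.

(* Rooted plane trees: [Graft e plus s t] is [t] with, attached at its root   *)
(* to the left of everything else, an edge just above the root of [s]. The    *)
(* edge is named [e], and marked "+" when [plus].                             *)
Inductive ptree : Type :=
| Root
| Graft of nat & bool & ptree & ptree.

Fixpoint attach (s t : ptree) : ptree :=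
  if s is Graft e plus s1 s2 then Graft e plus s1 (attach s2 t) else t.

(* A(w) for a word [w] starting at position [o] of the ambient string; an     *)
(* edge is named by the position (counted from 0) of its 1, or of the first   *)
(* of its two 1's in the case of a 11-pair. The counter [n] only serves       *)
(* termination: any [n >= size w] yields the same tree. In the first and last *)
(* cases, A(1z2w) and A(zw) are expanded by A(zw) = attach A(z) A(w), z in Z. *)
Fixpoint tree_rec (m n o : nat) (w : seq bool) : ptree :=
  match n, w with
  | n'.+1, false :: w' => tree_rec m n' o.+1 w'
  | n'.+1, true :: w' =>
    let k := zlen w' in
    let tz := tree_rec m n' o.+1 (take k w') in
    let tr := tree_rec m n' (o + k.+2) (drop k.+1 w') in
    let j := unpaired_ones w in
    if closes w' then Graft o false tz tr                       (* 1 z 2 w   *)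
    else if j <= m then
      Graft o (j == m) (tree_rec m n' o.+1 w') Root             (* terminal  *)
    else if odd (j - m) then tree_rec m n' o.+1 w'              (* extra     *)
    else Graft o true (attach tz tr) Root                       (* 1 z 1 w   *)
  | _, _ => Root
  end.

Definition tree (m : nat) (w : seq bool) : ptree := tree_rec m (size w) 0 w.

Lemma tree_rec_fuel (m n o : nat) (w : seq bool) :
  size w <= n -> tree_rec m n o w = tree_rec m (size w) o w.
Proof.
move: {2}(size w) (leqnn (size w)) => s.
elim: s n o w => [|s IH] n o [|[] w] //=; try by case: n.
all: case: n => [|n] // hs hn; rewrite !ltnS in hs hn.
  have Et k o' : tree_rec m n o' (take k w) = tree_rec m (size w) o' (take k w).
    have h : size (take k w) <= size w by rewrite size_take; case: ltnP; lia.
    by rewrite !(IH _ _ (take k w)) //; lia.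
  have Ed k o' : tree_rec m n o' (drop k w) = tree_rec m (size w) o' (drop k w).
    have h : size (drop k w) <= size w by rewrite size_drop; lia.
    by rewrite !(IH _ _ (drop k w)) //; lia.
  by rewrite /= Et Ed (IH n).
by rewrite /= (IH n).
Qed.

Fixpoint root_edges (t : ptree) : seq nat :=
  if t is Graft e _ _ t' then e :: root_edges t' else [::].

Fixpoint edges (t : ptree) : seq nat :=
  if t is Graft e _ s t' then e :: edges s ++ edges t' else [::].

Fixpoint plus_edges (t : ptree) : seq nat :=
  if t is Graft e plus s t'
  then (if plus then [:: e] else [::]) ++ plus_edges s ++ plus_edges t'
  else [::].

Fixpoint leaf_edges (t : ptree) : seq nat :=
  if t is Graft e _ s t'
  then (if s is Root then [:: e] else leaf_edges s) ++ leaf_edges t'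
  else [::].

(* Pairs (e, e') of consecutive edges, [e] being the one closer to the root. *)
Fixpoint child_edges (t : ptree) : seq (nat * nat) :=
  if t is Graft e _ s t'
  then [seq (e, e') | e' <- root_edges s] ++ child_edges s ++ child_edges t'
  else [::].

Definition subword (w : seq bool) (i j : nat) : seq bool :=
  take (j - i) (drop i w).

(* [w = 1 z_{n-1} 1 ... z_1 1 z_0] with [n] displayed 1's. Each z_i is        *)
(* followed by a displayed (hence unpaired) 1 or by the end of the word, so   *)
(* it is the longest prefix in Z of what follows the preceding 1.             *)
Fixpoint one_blocks (n : nat) (w : seq bool) : bool :=
  match n, w with
  | 0, [::] => true
  | n'.+1, true :: w' => one_blocks n' (drop (zlen w') w')
  | _, _ => false
  end.

(* [w = w' z w''] with [size w' = i], [size (w' z) = j], where w'' has        *)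
(* [m + 2r] displayed 1's and z is non-empty, in Z, and maximal.              *)
Definition prec_block (m : nat) (w : seq bool) (i j : nat) : bool :=
  [&& i < j, inZ (subword w i j),
      all (fun i' => ~~ inZ (subword w i' j)) (iota 0 i)
    & has (fun r => one_blocks (m + r.*2) (drop j w)) (iota 0 (size w))].

(* If [z = x_s ... x_1] with indecomposable x_k, this is the sequence of the  *)
(* starting positions of x_s, ..., x_1 and w'': these are the positions after *)
(* the prefixes of z that belong to Z. They name the maximal edges of         *)
(* A(x_s), ..., A(x_1) and A(w'').                                            *)
Definition factor_starts (w : seq bool) (i j : nat) : seq nat :=
  [seq k <- iota i (j - i).+1 | inZ (subword w i k)].

(* The edge [f] immediately precedes the edge [e]. *)
Definition imm_precedes (m : nat) (w : seq bool) (f e : nat) : bool :=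
  [exists i : 'I_(size w), exists j : 'I_(size w),
    prec_block m w i j && infix [:: e; f] (factor_starts w i j)].

Definition edge_type (m : nat) (b : seq bool) : finType :=
  seq_sub (edges (tree m b)).

Definition precedes (m : nat) (b : seq bool) (f e : edge_type m b) : bool :=
  let imm := [rel x y : edge_type m b | imm_precedes m b (val x) (val y)] in
  [exists g, imm f g && connect imm g e].

(* The capacity of the leaf edge [e]. Both kinds of leaves are covered: for   *)
(* [b = b'12b''] with [size b' = e], the two prefixes are a'v and b'1; if [e] *)
(* is the last position, they are [a] and [b].                                *)
Definition capacity (a b : seq bool) (e : nat) : nat :=
  ones (take e.+1 a) - ones (take e.+1 b).

(* Labels never exceed the capacity of some leaf, hence are at most [size a]. *)
Definition labels (m : nat) (a b : seq bool) : finType :=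
  {ffun edge_type m b -> 'I_(size a).+1}.

Definition labelling (m : nat) (a b : seq bool) (nu : labels m a b) : bool :=
  [&& [forall e, (val e \in leaf_edges (tree m b)) ==>
                   (nu e <= capacity a b (val e))],
      [forall e, forall e', ((val e, val e') \in child_edges (tree m b)) ==>
                              (nu e <= nu e')],
      [forall e, (val e \in plus_edges (tree m b)) ==> ~~ odd (nu e)]
    & [forall e, [exists f, precedes f e]
                   && [forall f, precedes f e ==> (nu e <= nu f)]
                   ==> ~~ odd (nu e)]].

Definition label_sum (m : nat) (a b : seq bool) (nu : labels m a b) : nat :=
  \sum_(e : edge_type m b) nu e.

(* The generating function R^B; the variable t is ['X]. *)
Definition RB (m : nat) (a b : seq bool) : {poly int} :=
  (\sum_(nu : labels m a b | labelling nu) 'X^(2 * label_sum nu))%R.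

(* Main.v *)
(* Cut the region into layers, layer k consisting of the boxes lying along the
   path of b shifted up by 2k. Rule Ia forces every strip of a configuration to
   stay in one layer and the strips of layer k + 1 to be refinements of those of
   layer k, so a configuration is determined by its profile: the function c
   sending a letter p of b to the number of layers in which p lies inside a
   strip. The nonempty words that strips can carry are exactly the
   concatenations of words read below the edges of A(b) (this uses rule 0 and
   the odd part of rule Ib), so profiles correspond to labellings of the edges
   that are monotone along A(b): the label of an edge is the value of c at its
   letter, and c p is the largest label of an edge above p. Capacities express
   that the boxes of the strips exist, since the depth of the region is smallest
   at the peaks of b, that is at the leaves of A(b). Finally, for a suffix x..N
   containing at least m unpaired 1's, let mu(x) be the minimum of c over it.
   The last strips of mu(x) - mu(x - 1) layers start exactly at x, so the even
   part of rule Ib says that all mu(x) are even, and going leftwards through the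
   letters this is equivalent to the parity conditions on the edges marked "+"
   and on those that do not exceed their preceding edges. *)

Require Import Defs.
From mathcomp Require Import all_boot all_order all_algebra.
From mathcomp Require Import finmap zify.

Set Implicit Arguments.
Unset Strict Implicit.
Unset Printing Implicit Defensive.

Import Order.TTheory GRing.Theory Num.Theory.

Local Open Scope nat_scope.

(** * Heights and admissible words *)

Section Heights.
Variable b : seq bool.

Lemma height0 : height b 0 = 0%R.
Proof. by rewrite /height take0. Qed.

Lemma heightS v : v < size b ->
  height b v.+1 = (height b v + (if nth false b v then 1 else -1))%R.
Proof.
move=> lt_v; rewrite /height (take_nth false lt_v) -cats1 /ones /twos !count_cat /=.
by case: (nth _ _ _) => /=; lia.
Qed.

(** Length is ones plus twos and rise is ones minus twos, so the two always have the same parity. *)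
Lemma letter_count x y : x <= y <= size b ->
  ((\sum_(x <= i < y) nth false b i : nat).*2%:Z = (y - x)%:Z + height b y - height b x)%R.
Proof.
elim: y => [|y IH] hxy.
  by have -> : x = 0 by [lia]; rewrite big_geq //; lia.
case: (ltngtP x y.+1) => hx; [|lia|].
  rewrite big_nat_recr //=; have := IH ltac:(lia); rewrite (@heightS y); last lia.
  by case: nth => /=; lia.
by rewrite hx big_geq //; lia.
Qed.

Lemma height_growth x y : x <= y <= size b -> (height b y <= height b x + (y - x)%:Z)%R.
Proof.
elim: y => [|y IH] hxy.
  have -> : x = 0 by lia.
  by rewrite addr0.
case: (ltngtP x y.+1) => [hx||->]; [|lia|by rewrite subnn addr0].
by have := IH ltac:(lia); rewrite (@heightS y); [case: nth; lia|lia].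
Qed.

Definition above x y := all (fun v => height b x <= height b v)%R (iota x (y - x).+1).

Lemma aboveP x y : x <= y ->
  reflect (forall v, x <= v <= y -> (height b x <= height b v)%R) (above x y).
Proof.
move=> le_xy; apply: (iffP allP) => H v Hv; apply: H; move: Hv; rewrite ?mem_iota; lia.
Qed.

Variable m : nat.

(* The vertices [x], ..., [y] of the path of [b] may carry a strip: rule 0    *)
(* forces [y = size b] when the word between them has unpaired 1's, and rule  *)
(* Ib excludes [l' - m] odd.                                                  *)
Definition valid x y :=
  [&& x <= y <= size b, above x y &
      (height b y == height b x) || ((y == size b) &&
        let l := `|height b y - height b x|%N in (l < m) || ~~ odd (l - m))].

Lemma validP x y :
  reflect [/\ x <= y <= size b,
     forall v, x <= v <= y -> (height b x <= height b v)%R &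
     height b y = height b x \/ y = size b /\
        (let l := `|height b y - height b x|%N in (l < m) \/ ~~ odd (l - m))]
  (valid x y).
Proof.
apply: (iffP and3P) => [[hxy /aboveP h1 h2]|[hxy h1 h2]]; split => //.
- by apply: h1; case/andP: hxy.
- case/orP: h2 => [/eqP|/andP[/eqP h2 /orP h3]]; first by left.
  by right.
- by apply/aboveP => //; case/andP: hxy.
- case: h2 => [->|[-> h]]; first by rewrite eqxx.
  by rewrite eqxx /=; apply/orP; right; apply/orP.
Qed.

Lemma valid_shape x y : valid x y ->
  exists l l', y = x + l.*2 + l' /\ height b y = (height b x + l'%:Z)%R.
Proof.
case/validP => hxy H _; have := letter_count hxy; have := height_growth hxy.
have := H y ltac:(lia) => h1 h2 h3.
by exists ((y - x - `|height b y - height b x|%N)./2), `|height b y - height b x|%N; split; lia.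
Qed.

Lemma valid_refl x : x <= size b -> valid x x.
Proof.
move=> h; apply/validP; split; [lia| |by left].
by move=> v hv; have -> : v = x by lia.
Qed.

(* Letters are named by their left vertex. The letter 1 at [x] carries an edge *)
(* of the tree iff some nonempty strip starts at [x]; the letters below that   *)
(* edge are those in [x, endp x). [endp x = (size b).+1] when there is none.   *)
Definition endp x := x.+1 + find (valid x) (iota x.+1 (size b - x)).

Definition edge x := endp x <= size b.

Lemma lt_endp x : x < endp x. Proof. rewrite /endp; lia. Qed.

Lemma edge_lt x : edge x -> x < size b.
Proof. rewrite /edge; have := lt_endp x; lia. Qed.

Lemma valid_endp x : edge x -> valid x (endp x).
Proof.
rewrite /edge /endp => h.
have hf : find (valid x) (iota x.+1 (size b - x)) < size b - x by lia.
have := nth_find 0 (_ : has (valid x) (iota x.+1 (size b - x))).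
rewrite has_find size_iota hf nth_iota //; exact.
Qed.

Lemma before_endp x y : x < y < endp x -> ~~ valid x y.
Proof.
rewrite /endp => h.
case: (leqP y (size b)) => hy; last by apply/negP => /validP[]; lia.
have hi : y - x.+1 < find (valid x) (iota x.+1 (size b - x)) by lia.
have := before_find 0 hi; rewrite nth_iota; last by lia.
have -> : x.+1 + (y - x.+1) = y by lia.
by move=> ->.
Qed.

Lemma endp_le x y : x < y -> valid x y -> endp x <= y.
Proof.
move=> lxy v; rewrite leqNgt; apply/negP => h.
by have := before_endp (_ : x < y < endp x); rewrite v lxy h => /(_ isT).
Qed.

Lemma valid_edge x y : x < y -> valid x y -> edge x.
Proof.
move=> lxy v; have := endp_le lxy v; case/validP: v; rewrite /edge; lia.
Qed.

(** A return to the height of [x] strictly before [endp x] would close a shorter valid word. So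
    [endp x] is the first return (paired 1) or the end of the string (unpaired 1). *)
Lemma endpP x : edge x -> [/\ x < endp x <= size b,
  forall v, x <= v <= endp x -> (height b x <= height b v)%R,
  forall v, x < v < endp x -> (height b x < height b v)%R &
  height b (endp x) = height b x \/ endp x = size b /\
    (let l := `|height b (size b) - height b x|%N in (l < m) \/ ~~ odd (l - m))].
Proof.
move=> ex; have /validP[h1 h2 h3] := valid_endp ex; have lx := lt_endp x.
split => //; first lia.
  move=> v hv; rewrite lt_neqAle h2 ?andbT; last lia.
  apply/eqP => e; have /negP[] := before_endp hv; apply/validP; split; [lia| |by left].
  by move=> w hw; apply: h2; lia.
case: h3 => [|[h3 h4]]; [by left|right]; split => //.
by rewrite -[X in height b X]h3.
Qed.

Lemma edge_letter x : edge x -> nth false b x.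
Proof.
move=> ex; have [h1 h2 _ _] := endpP ex.
have := h2 x.+1 ltac:(lia); rewrite heightS ?edge_lt //; case: nth => //; lia.
Qed.

(** Either [endp x] is back at the base height, which the remainder inherits, or it is the end of
    the string and the remainder is empty. *)
Lemma valid_tail x y : x < y -> valid x y -> valid (endp x) y.
Proof.
move=> lxy vxy; have exy := endp_le lxy vxy; have ex := valid_edge lxy vxy.
have /validP[h1 h2 h3] := vxy.
have [g1 g2 _ [g3|[g3 _]]] := endpP ex.
  apply/validP; split; [lia| |by rewrite g3].
  by move=> v hv; rewrite g3; apply: h2; lia.
have -> : y = endp x by lia.
by apply: valid_refl; lia.
Qed.

Lemma valid_cat x y : edge x -> valid (endp x) y -> valid x y.
Proof.
move=> ex /validP[h1 h2 h3]; have [g1 g2 _ [g3|[g3 _]]] := endpP ex.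
  apply/validP; split; [lia| |by rewrite -g3].
  move=> v hv; case: (leqP v (endp x)) => hv'; first by apply: g2; lia.
  by rewrite -g3; apply: h2; lia.
have -> : y = endp x by lia.
exact: valid_endp.
Qed.

(** If [y < endp e], the word would end at [y] at the height of [x], while the path strictly inside
    the interval of [e] stays above the height of [e], which is no lower than that of [x]. *)
Lemma valid_laminar x y e : valid x y -> x <= e < y -> edge e -> endp e <= y.
Proof.
move=> /validP[h1 h2 h3] he ee; have [g1 g2 g3 g4] := endpP ee.
rewrite leqNgt; apply/negP => hy.
have h4 : height b y = height b x by case: h3 => // -[]; lia.
have := g3 y; have := h2 e; lia.
Qed.

Lemma edge_laminar x e : edge x -> x <= e < endp x -> edge e -> endp e <= endp x.
Proof. by move=> ex; apply: valid_laminar; apply: valid_endp. Qed.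

Lemma valid_cover x y p : valid x y -> x <= p < y ->
  exists e, [/\ edge e, x <= e <= p, p < endp e & endp e <= y].
Proof.
move: {2}(y - x) (leqnn (y - x)) => n; elim: n x => [|n IH] x hn v hp; first lia.
have lxy : x < y by lia.
have hx := valid_edge lxy v; have hl := endp_le lxy v.
case: (ltnP p (endp x)) => hpe.
  by exists x; split => //; lia.
have lx := lt_endp x.
have [|||e [e1 e2 e3 e4]] := IH (endp x); [lia|exact: valid_tail|lia|].
by exists e; split => //; lia.
Qed.

(** The edge covering the first letter starts there and is cut off; by laminarity the edges covering
    the remaining letters start after its interval. *)
Lemma valid_union x y : x <= y <= size b ->
  (forall p, x <= p < y ->
    exists e, [/\ edge e, x <= e <= p, p < endp e & endp e <= y]) ->
  valid x y.
Proof.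
move: {2}(y - x) (leqnn (y - x)) => n; elim: n x => [|n IH] x hn hxy H.
  have -> : x = y by lia.
  by apply: valid_refl; lia.
have [->|lxy] : x = y \/ x < y by lia.
  by apply: valid_refl; lia.
have [e [e1 e2 e3 e4]] := H x ltac:(lia).
have E : e = x by lia.
subst e; apply: valid_cat => //; apply: IH; [lia|lia|].
move=> p hp; have [e [f1 f2 f3 f4]] := H p ltac:(lia).
exists e; split => //; apply/andP; split; last by lia.
rewrite leqNgt; apply/negP => he; have := edge_laminar e1 _ f1; lia.
Qed.

(* The suffix from [x] on is a strip containing an edge marked "+". *)
Definition long x := valid x (size b) && (m <= `|height b (size b) - height b x|%N).

Hypothesis m_gt0 : 0 < m.

Lemma longP x :
  reflect [/\ x < size b,
     forall v, x <= v <= size b -> (height b x <= height b v)%R &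
     exists r, height b (size b) = (height b x + (m + r.*2)%:Z)%R] (long x).
Proof.
apply: (iffP andP) => [[/validP[h1 h2 h3] h4]|[h1 h2 [r h3]]].
  have hx := h2 (size b).
  split => //; first by case: (ltngtP x (size b)) => // [|E]; [lia|move: h4; rewrite E subrr; lia].
  exists (`|height b (size b) - height b x|%N - m)./2.
  case: h3 => [E|[_ [h3|h3]]]; [lia|lia|].
  have := odd_double_half (`|height b (size b) - height b x|%N - m).
  lia.
split; last by lia.
apply/validP; split => //; [lia|right; split => //; right].
have -> : `|(height b (size b) - height b x)%R|%N - m = r.*2 by lia.
by rewrite odd_double.
Qed.

Lemma long_left x y : valid x (size b) -> x <= y -> long y -> long x.
Proof.
move=> vx hxy /longP[h1 h2 [r h3]]; rewrite /long vx /=.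
by case/validP: vx => _ h _; have := h y; lia.
Qed.

Lemma long_strip x l l' : long x -> x + l.*2 + l' = size b ->
  height b (size b) = (height b x + l'%:Z)%R ->
  (m <= l') && ~~ odd (l' - m).
Proof.
move=> /longP[_ _ [r hr]] El Eh; have -> : l' = m + r.*2 by lia.
by rewrite addKn odd_double leq_addr.
Qed.

End Heights.

(** * Words of the definitions in terms of heights *)

Section Words.
Variable b : seq bool.

Lemma size_subword x y : x <= y <= size b -> size (subword b x y) = y - x.
Proof. by move=> h; rewrite /subword size_take size_drop; case: ltnP; lia. Qed.

Lemma take_subword x y k : x + k <= y -> take k (subword b x y) = subword b x (x + k).
Proof.
by move=> h; rewrite /subword take_takel; [congr take|]; lia.
Qed.

Lemma drop_subword x y k : x + k <= y -> drop k (subword b x y) = subword b (x + k) y.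
Proof.
move=> h; rewrite /subword -[y - x](@subnK k); last lia.
by rewrite -take_drop drop_drop addnC; congr take; lia.
Qed.

Lemma subword_cons x y : x < y <= size b ->
  subword b x y = nth false b x :: subword b x.+1 y.
Proof.
move=> h; rewrite /subword (drop_nth false); last lia.
by have -> : y - x = (y - x.+1).+1 by lia.
Qed.

Lemma subword_drop x : subword b x (size b) = drop x b.
Proof. by rewrite /subword take_oversize // size_drop. Qed.

Lemma nth_subword x y k : x + k < y -> nth false (subword b x y) k = nth false b (x + k).
Proof. by move=> h; rewrite nth_take ?nth_drop //; lia. Qed.

Lemma height_subword x y k : x + k <= y ->
  ((ones (take k (subword b x y)))%:Z - (twos (take k (subword b x y)))%:Z
   = height b (x + k) - height b x)%R.
Proof.
move=> h; rewrite take_takel; last lia.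
by rewrite /height takeD /ones /twos !count_cat; lia.
Qed.

Lemma inZ_subword x y : x <= y <= size b ->
  inZ (subword b x y) = above b x y && (height b y == height b x).
Proof.
move=> hxy; apply/idP/andP => [hz|[/aboveP h1 /eqP h2]].
  split.
    apply/aboveP => [|v hv]; first lia.
    have := inZ_prefix (v - x) hz; have := @height_subword x y (v - x).
    have -> : x + (v - x) = v by lia.
    by move=> /(_ ltac:(lia)); lia.
  have /andP[/eqP e _] := hz; have := @height_subword x y (y - x).
  rewrite take_oversize ?size_subword //.
  have -> : x + (y - x) = y by lia.
  by move=> /(_ ltac:(lia)); lia.
have E := size_subword hxy.
apply: inZ_intro => [|k].
  have := @height_subword x y (y - x).
  rewrite take_oversize ?E //.
  have -> : x + (y - x) = y by lia.
  by move=> /(_ ltac:(lia)); lia.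
have [hk|hk] := leqP (x + k) y.
  by have := height_subword hk; have := h1 ltac:(lia) (x + k) ltac:(lia); lia.
have := @height_subword x y (y - x); rewrite !take_oversize ?E //; last lia.
have -> : x + (y - x) = y by lia.
by move=> /(_ ltac:(lia)); lia.
Qed.

Lemma inZ_subwordP x y : x <= y <= size b ->
  reflect ((forall v, x <= v <= y -> (height b x <= height b v)%R)
           /\ height b y = height b x) (inZ (subword b x y)).
Proof.
move=> hxy; rewrite inZ_subword //; apply: (iffP andP) => -[h1 h2]; split.
- by apply/aboveP => //; lia.
- exact/eqP.
- by apply/aboveP => //; lia.
- exact/eqP.
Qed.

Lemma zlenP (w : seq bool) : [/\ zlen w <= size w, inZ (take (zlen w) w) &
  forall k, k <= size w -> inZ (take k w) -> k <= zlen w].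
Proof.
rewrite /zlen; set s := [seq _ <- _ | _].
have s0 : 0 \in s by rewrite mem_filter take0 mem_iota.
have hs k : (k \in s) = inZ (take k w) && (k <= size w).
  by rewrite mem_filter mem_iota ltnS.
have srt : sorted ltn s by apply: sorted_filter (iota_ltn_sorted _ _); exact: ltn_trans.
have hl : last 0 s \in s.
  by case: (s) s0 => // x s' _ /=; rewrite mem_last.
have:= hl; rewrite hs => /andP[-> ->]; split => // k hk hz.
have : k \in s by rewrite hs hz hk.
case: (s) srt => // x s' /= p; move: k {hk hz}; apply/allP.
elim: s' x p => [|y s' IH] x /=; first by rewrite leqnn.
case/andP => xy /IH /= /andP[h ->]; rewrite h !andbT.
exact: leq_trans (ltnW xy) h.
Qed.

Lemma closesE w : closes w = (zlen w < size w) && ~~ nth false w (zlen w).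
Proof.
rewrite /closes; case: (ltnP (zlen w) (size w)) => h.
  by rewrite (drop_nth false) //; case: nth.
by rewrite drop_oversize.
Qed.

(** The vertex [s] follows the longest Z-word after the 1 at [o]. A 2 at [s] closes that 1;
    otherwise a later return to the height of [s] would extend the Z-word, so up to [y] the path
    stays above it. *)
Lemma closes_spec o y : o < y <= size b -> nth false b o ->
  let w := subword b o.+1 y in let s := o.+1 + zlen w in
  [/\ s <= y, height b s = (height b o + 1)%R,
     forall u, o < u <= s -> (height b o < height b u)%R &
     if closes w then [/\ s < y, height b s.+1 = height b o & ~~ nth false b s]
     else (s < y -> nth false b s) /\
          forall u, s < u <= y -> (height b s < height b u)%R].
Proof.
move=> hoy bo w s.
have ho : height b o.+1 = (height b o + 1)%R by rewrite heightS ?bo //; lia.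
have sw : size w = y - o.+1 by rewrite size_subword //; lia.
have [z1 z2 z3] := zlenP w.
have hs : s <= y by rewrite /s; lia.
move: z2; rewrite take_subword // => /inZ_subwordP[|h1 h2]; first lia.
have h1' u : o < u <= s -> (height b o < height b u)%R.
  by move=> hu; have := h1 u hu; lia.
split => //; first by rewrite h2.
rewrite closesE sw; case: (ltnP s y) => sy; last first.
  have -> : (zlen w < y - o.+1) = false by lia.
  by split => [|u]; lia.
have -> : zlen w < y - o.+1 by lia.
rewrite /= nth_subword // -/s; case bs : (nth false b s) => /=.
  split => // u; move: {2}u (leqnn u) => n; elim: n u => [|n IH] u hun hu; first lia.
  case: u hun hu => [|u] hun hu; first lia.
  have us : height b u.+1 = (height b u + (if nth false b u then 1 else -1))%R.
    by rewrite heightS //; lia.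
  case: (ltngtP s u) => su; [|lia|].
    have hu2 := IH u ltac:(lia) ltac:(lia).
    have : height b u.+1 <> height b s.
      move=> E; have := z3 (u - o); rewrite sw => /(_ ltac:(lia)).
      rewrite take_subword ?inZ_subword; [|lia|lia].
      have -> : o.+1 + (u - o) = u.+1 by lia.
      have -> : above b o.+1 u.+1.
        apply/aboveP => [|v hv]; first lia.
        case: (leqP v s) => hv'; first by apply: h1; lia.
        have : v = u.+1 \/ s < v <= u by lia.
        case=> [->|hv2]; first by rewrite E -/s h2.
        by rewrite -h2 -/s; apply/ltW/IH; lia.
      rewrite E -/s h2 eqxx => /(_ isT); lia.
    by rewrite us; case: nth us => us; lia.
  by rewrite us -su bs; lia.
by split => //; rewrite heightS ?bs ?h2 ?ho; lia.
Qed.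

(* Unpaired 1's of a suffix are the record lows read from the right. *)
Lemma unpaired_onesP o : o <= size b ->
  exists v, [/\ o <= v <= size b,
    forall u, o <= u <= size b -> (height b v <= height b u)%R &
    height b (size b) = (height b v + (unpaired_ones (drop o b))%:Z)%R].
Proof.
move: {2}(size b - o) (leqnn (size b - o)) => n; elim: n o => [|n IH] o hn ho.
  have -> : o = size b by lia.
  exists (size b); rewrite drop_size /= addr0; split => // [|u hu]; first lia.
  by have -> : u = size b by lia.
case: (ltngtP o (size b)) => oN; [|lia|]; last first.
  exists (size b); rewrite oN drop_size /= addr0; split => // [|u hu]; first lia.
  by have -> : u = size b by lia.
have [v [h1 h2 h3]] := IH o.+1 ltac:(lia) oN.
rewrite (drop_nth false) //=; have hs := heightS oN.
case bo : (nth false b o) hs => hs /=; last first.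
  rewrite add0n; exists v; split => // [|u hu]; first lia.
  case: (ltngtP o u) hu => [ou|uo|<-] hu; [by apply: h2; lia|lia|].
  by have := h2 o.+1 ltac:(lia); rewrite hs; lia.
have := @closes_spec o (size b) ltac:(lia) bo; rewrite subword_drop /=.
set s := _ + _; case: closes => -[k1 k2 k3 k4] /=.
  case: k4 => k4 k5 _; exists v; rewrite add0n; split => // [|u hu]; first lia.
  case: (ltngtP o u) hu => [ou|uo|<-] hu; [by apply: h2; lia|lia|].
  by rewrite -k5; apply: h2; lia.
case: k4 => _ k4.
have hlow u : o < u <= size b -> (height b o + 1 <= height b u)%R.
  move=> hu; case: (leqP u s) => us; first by have := k3 u ltac:(lia); lia.
  by have := k4 u ltac:(lia); lia.
have hv : height b v = (height b o + 1)%R.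
  by have := h2 o.+1 ltac:(lia); have := hlow v ltac:(lia); rewrite hs; lia.
exists o; split => // [|u hu|]; first lia; last by rewrite h3 hv; lia.
case: (ltngtP o u) hu => [ou|uo|<-] hu; [|lia|by []].
by have := hlow u ltac:(lia); lia.
Qed.

Lemma unpaired_ones_above o : o <= size b ->
  (forall u, o <= u <= size b -> (height b o <= height b u)%R) ->
  height b (size b) = (height b o + (unpaired_ones (drop o b))%:Z)%R.
Proof.
move=> ho h; have [v [h1 h2 ->]] := unpaired_onesP ho.
by have := h v h1; have := h2 o ltac:(lia); lia.
Qed.

(** Each displayed 1 lifts the base by one and the Z-words in between never fall below it, whereas a
    paired 1 in its place would bring the path back down. *)
Lemma one_blocksP n j : j <= size b ->
  reflect ((forall v, j < v <= size b -> (height b j < height b v)%R)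
           /\ height b (size b) = (height b j + n%:Z)%R)
          (one_blocks n (drop j b)).
Proof.
elim: n j => [|n IH] j hj.
  case: (ltngtP j (size b)) => jN; [|lia|].
    rewrite (drop_nth false) //; apply: (iffP idP) => //= -[h1 h2].
    by have := h1 (size b); lia.
  rewrite jN drop_size; apply: (iffP idP) => // _; split => [v|]; first lia.
  by rewrite addr0.
case: (ltngtP j (size b)) => jN; [|lia|]; last first.
  by rewrite jN drop_size; apply: (iffP idP) => //= -[]; lia.
rewrite (drop_nth false) //; have hs := heightS jN.
case bj : (nth false b j) hs => hs /=; last first.
  by apply: (iffP idP) => // -[h1 h2]; have := h1 j.+1 ltac:(lia); rewrite hs; lia.
have := @closes_spec j (size b) ltac:(lia) bj; rewrite subword_drop /=.
rewrite drop_drop [zlen _ + _]addnC; set s := _ + _.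
case: closes => -[k1 k2 k3 k4].
  case: k4 => k4 k5 k6; apply: (iffP idP) => [/(IH _ k1)[h1 h2]|[h1 h2]].
    by have := h1 s.+1; rewrite k5 k2; lia.
  by have := h1 s.+1; rewrite k5; lia.
case: k4 => _ k4; apply: (iffP (IH _ k1)) => -[h1 h2].
  split; last by rewrite h2 k2; lia.
  move=> v hv; case: (leqP v s) => vs; first by apply: k3; lia.
  by have := h1 v; rewrite k2; lia.
by split; [exact: k4 | rewrite h2 k2; lia].
Qed.

End Words.

(** * Trees *)

Fixpoint desc_edges (t : ptree) : seq (nat * nat) :=
  if t is Graft e _ s t'
  then [seq (e, e') | e' <- edges s] ++ desc_edges s ++ desc_edges t'
  else [::].

Lemma root_edges_sub t e : e \in root_edges t -> e \in edges t.
Proof.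
elim: t => //= e' _ s _ t IH; rewrite !inE mem_cat => /orP[->//|/IH ->].
by rewrite !orbT.
Qed.

Lemma edges_attach s t : edges (attach s t) = edges s ++ edges t.
Proof. by elim: s => //= e p s1 _ s2 ->; rewrite catA. Qed.

Lemma plus_edges_attach s t : plus_edges (attach s t) = plus_edges s ++ plus_edges t.
Proof. by elim: s => //= e p s1 _ s2 ->; rewrite !catA. Qed.

Lemma leaf_edges_attach s t : leaf_edges (attach s t) = leaf_edges s ++ leaf_edges t.
Proof. by elim: s => //= e p s1 _ s2 ->; rewrite catA. Qed.

Lemma child_edges_attach s t : child_edges (attach s t) = child_edges s ++ child_edges t.
Proof. by elim: s => //= e p s1 _ s2 ->; rewrite !catA. Qed.

Lemma desc_edges_attach s t : desc_edges (attach s t) = desc_edges s ++ desc_edges t.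
Proof. by elim: s => //= e p s1 _ s2 ->; rewrite !catA. Qed.

(** Every edge of a tree has a value at least that of some root edge, and the root edges of a
    subtree are the children of the edge grafted onto it. *)
Lemma child_desc (f : nat -> nat) t :
  (forall x y, (x, y) \in child_edges t -> f x <= f y) ->
  forall x y, (x, y) \in desc_edges t -> f x <= f y.
Proof.
have root_low s : (forall x y, (x, y) \in desc_edges s -> f x <= f y) ->
    forall y, y \in edges s -> exists2 x, x \in root_edges s & f x <= f y.
  elim: s => //= e p s1 IH1 s2 IH2 H y; rewrite inE mem_cat => /or3P[/eqP ->|h|h].
  - by exists e; rewrite ?mem_head.
  - exists e; rewrite ?mem_head //; apply: H.
    by rewrite mem_cat map_f.
  - have [|x hx hxy] := IH2 _ _ h.
      by move=> x z hxz; apply: H; rewrite !mem_cat hxz !orbT.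
    by exists x; rewrite // inE hx orbT.
elim: t => //= e p s IHs t IHt H.
have hs x y : (x, y) \in desc_edges s -> f x <= f y.
  by apply: IHs => {}x {}y h; apply: H; rewrite !mem_cat h orbT.
move=> x y; rewrite !mem_cat => /or3P[/mapP[z hz [-> ->]]||]; first 1 last.
- exact: hs.
- by apply: IHt => {}x {}y h; apply: H; rewrite !mem_cat h !orbT.
have [x' hx' h] := root_low _ hs _ hz.
by apply: leq_trans h; apply: H; rewrite mem_cat map_f.
Qed.

Section Tree.
Variables (b : seq bool) (m : nat).
Hypothesis m_gt0 : 0 < m.
Notation edge := (edge b m).
Notation endp := (endp b m).
Notation N := (size b).

(* Such letters carry the leaf edges. *)
Definition peak e := nth false b e && ((e.+1 == N) || ~~ nth false b e.+1).

Lemma peak_edge e : peak e -> edge e /\ endp e <= e.+2.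
Proof.
move=> /andP[be he]; have eN : e < N.
  by rewrite ltnNge; apply/negP => /(nth_default false) E; rewrite E in be.
 have h1 := heightS eN; rewrite be in h1.
case: (ltngtP e.+1 N) he => e1N he; [|lia|].
  have h2 := heightS e1N; rewrite (negbTE he) in h2.
  have v : valid b m e e.+2.
    apply/validP; split; [lia|move=> v hv|left; lia].
    have [->|[->|->]] : v = e \/ v = e.+1 \/ v = e.+2 by lia.
    - by [].
    - by rewrite h1; lia.
    - by rewrite h2 h1; lia.
  split; first by apply: (valid_edge _ v).
  by apply: endp_le v.
have v : valid b m e e.+1.
  apply/validP; split; [lia|move=> v hv|right; split => //].
    have [->|->] : v = e \/ v = e.+1 by lia.
      by [].
    by rewrite h1; lia.
  (* Here l' = 1 is below [m] or equal to it, so a final 1 is never excluded. *)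
  by rewrite h1 /=; case: (m) m_gt0 => [|[|?]] //; [right; lia|left; lia].
split; first by apply: (valid_edge _ v).
by have := endp_le (ltnSn e) v; lia.
Qed.

(** Describes the tree of the letters from [x] to [y] by positions alone. The descendant and leaf
    clauses serve to draw constraints from a labelling, the child clause to check that a profile
    meets them. *)
Record tree_of x y t : Prop := TreeOf {
  tree_edges : forall e, (e \in edges t) = (x <= e < y) && edge e;
  tree_desc : forall e e', x <= e < y -> edge e -> edge e' -> e < e' < endp e ->
    (e, e') \in desc_edges t;
  tree_child : forall e e', (e, e') \in child_edges t -> e < e' < endp e;
  tree_leaf : forall e, x <= e < y -> peak e -> e \in leaf_edges t;
  tree_plus : forall e, (e \in plus_edges t)
    = [&& x <= e < y, long b m e & endp e == N] }.

Lemma long_edge e : long b m e -> edge e.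
Proof.
by move=> h; have [h1 _ _] := longP b m_gt0 _ h; case/andP: h => /(valid_edge h1).
Qed.

Lemma tree_of_nil x y : (forall e, x <= e < y -> ~~ edge e) -> tree_of x y Root.
Proof.
move=> H; split => //= e.
- by rewrite in_nil; case: (boolP (_ <= _ < _)) => // /H /negbTE ->.
- by move=> e' he ee; have := H e he; rewrite ee.
- by move=> he /peak_edge[ee _]; have := H e he; rewrite ee.
- rewrite in_nil; case: (boolP (_ <= _ < _)) => //= /H he.
  by apply/esym/negbTE/negP => /andP[/long_edge]; rewrite (negbTE he).
Qed.

Lemma tree_of_cat x z y s t : x <= z <= y -> y <= N ->
  (forall e, x <= e < z -> edge e -> endp e <= z) ->
  tree_of x z s -> tree_of z y t -> tree_of x y (attach s t).
Proof.
move=> hz yN lam [s1 s2 s3 s4 s5] [t1 t2 t3 t4 t5].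
have E e : (x <= e < y) = (x <= e < z) || (z <= e < y) by lia.
split => e.
- by rewrite edges_attach mem_cat s1 t1 E andb_orl.
- move=> e' he ee ee' hee; rewrite desc_edges_attach mem_cat.
  move: he; rewrite E => /orP[he|he]; first by rewrite s2.
  by rewrite t2 ?orbT.
- by move=> e'; rewrite child_edges_attach mem_cat => /orP[/s3|/t3].
- move=> he pe; rewrite leaf_edges_attach mem_cat.
  move: he; rewrite E => /orP[he|he]; first by rewrite s4.
  by rewrite t4 ?orbT.
- by rewrite plus_edges_attach mem_cat s5 t5 E andb_orl.
Qed.

Lemma attach_Root t : attach t Root = t.
Proof. by elim: t => //= e p s _ t ->. Qed.

Lemma tree_of_skipl x z y t : x <= z <= y -> y <= N ->
  (forall e, x <= e < z -> ~~ edge e) -> tree_of z y t -> tree_of x y t.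
Proof.
move=> hz yN H ht; rewrite -[t]/(attach Root t); apply: tree_of_cat ht => //.
  by move=> e he ee; have := H e he; rewrite ee.
exact: tree_of_nil.
Qed.

Lemma tree_of_skipr x z y t : x <= z <= y -> y <= N ->
  (forall e, z <= e < y -> ~~ edge e) ->
  (forall e, x <= e < z -> edge e -> endp e <= z) ->
  tree_of x z t -> tree_of x y t.
Proof.
move=> hz yN H H' ht; rewrite -[t]attach_Root; apply: tree_of_cat ht _ => //.
exact: tree_of_nil.
Qed.

Lemma edges_nil t : (forall e, e \notin edges t) -> t = Root.
Proof. by case: t => //= e p s t /(_ e); rewrite mem_head. Qed.

Lemma tree_of_graft x y p s t : edge x -> endp x <= y -> y <= N ->
  p = long b m x && (endp x == N) ->
  tree_of x.+1 (endp x) s -> tree_of (endp x) y t -> tree_of x y (Graft x p s t).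
Proof.
move=> ex exy yN Ep hs ht.
have [s1 s2 s3 s4 s5] := hs.
have lx := lt_endp b m x.
rewrite -[Graft _ _ _ _]/(attach (Graft x p s Root) t); apply: tree_of_cat ht => //.
- by lia.
- by move=> e he; apply: edge_laminar.
split => e /=; rewrite ?cats0.
- rewrite inE s1; case: eqVneq => [->|ne] /=; first by rewrite ex lx leqnn.
  by congr (_ && _); lia.
- move=> e' he ee ee' hee; rewrite mem_cat; case: (eqVneq e x) => [E|ne].
    subst e; rewrite map_f //= s1 ee'; lia.
  by rewrite s2 ?orbT //; lia.
- move=> e'; rewrite mem_cat => /orP[|/s3//].
  case/mapP => z /root_edges_sub; rewrite s1 => hz [-> ->]; lia.
- move=> he pe; case: (eqVneq e x) => [E|ne].
    subst e; have [_ hend] := peak_edge pe.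
    (* The interval of a peak has at most two letters, the second being a 2, so the subtree has no
       edge. *)
    have -> : s = Root; last by rewrite mem_head.
    apply: edges_nil => e; rewrite s1; apply/negP => /andP[he2 ee].
    have := edge_letter ee; have E : e = x.+1 by lia.
    subst e; case/andP: pe => _ /orP[/eqP E|/negP//].
    by have := edge_lt ee; lia.
  by have := s4 e ltac:(lia) pe; case: (s).
- rewrite mem_cat s5; case: (eqVneq e x) => [->|ne].
    rewrite lx leqnn /= -Ep ltnn; case: (p) => //=.
    by rewrite mem_head.
  have -> : (e \in (if p then [:: x] else [::])) = false.
    by case: (p) => //; rewrite inE (negbTE ne).
  by rewrite /=; congr (_ && _); lia.
Qed.

Lemma paired_edge x y : x < y <= N ->
  (forall v, x < v < y -> (height b x < height b v)%R) -> height b y = height b x ->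
  edge x /\ endp x = y.
Proof.
move=> hy H E; have v : valid b m x y.
  apply/validP; split; [lia|move=> v hv|by left].
  have [->|[->|h]] : v = x \/ v = y \/ x < v < y by lia.
  - by [].
  - by rewrite E.
  - exact/ltW/H.
have lxy : x < y by lia.
have ex := valid_edge lxy v; split => //.
apply/eqP; rewrite eqn_leq (endp_le lxy v) leqNgt; apply/negP => h.
have [h1 h2 h3 [h4|[h4 _]]] := endpP ex; last lia.
by have := H (endp x); rewrite h4; lia.
Qed.

(** The path never returns to the height of [x], so a nonempty strip from [x] reaches the last
    vertex and has l' = [j]. Thus [j <= m] is a terminal 1, a positive even [j - m] the first 1 of a
    11-pair, and an odd [j - m] a 1 that carries no edge. *)
Lemma unpaired_edge x j : x < N ->
  (forall v, x < v <= N -> (height b x < height b v)%R) ->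
  height b N = (height b x + j%:Z)%R ->
  [/\ edge x = (j < m) || ~~ odd (j - m), edge x -> endp x = N &
      long b m x = (m <= j) && ~~ odd (j - m)].
Proof.
move=> xN H hj.
have El : `|(height b x + j%:Z - height b x)%R|%N = j by lia.
have vE : valid b m x N = (j < m) || ~~ odd (j - m).
  apply/validP/orP => [[_ _ [E|[_]]]|hjm]; last 1 first.
  - split; [lia|move=> v hv|by right; rewrite hj El].
    by case: (ltngtP x v) hv => [xv|vx|<-] hv; [apply/ltW/H; lia|lia|].
  - by have := H N ltac:(lia); rewrite E ltxx.
  - by rewrite hj El.
have Ee : edge x -> endp x = N /\ (j < m \/ ~~ odd (j - m)).
  move=> /endpP[h1 h2 _ [h3|[h3]]]; last by rewrite hj El.
  by have := H (endp x) ltac:(lia); rewrite h3 ltxx.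
split.
- apply/idP/idP => [/Ee[_ /orP//]|]; rewrite -vE; exact: valid_edge.
- by case/Ee.
- by rewrite /long vE hj El; case: (ltngtP j m) => //= ?; rewrite ?andbT ?andbF.
Qed.

(** Follows the recursion of [tree_rec]: each subword met is a suffix of [b] or lies in Z. All 1's
    of a Z-word are paired, so an unpaired 1 forces [y = N]. *)
Lemma tree_rec_of n o y : o <= y <= N -> y - o <= n ->
  y = N \/ inZ (subword b o y) -> tree_of o y (tree_rec m n o (subword b o y)).
Proof.
elim: n o y => [|n IH] o y hoy hn hz.
  have -> : o = y by lia.
  by rewrite /=; apply: tree_of_nil; lia.
case: (ltngtP o y) => oy; [|lia|]; last first.
  rewrite oy /subword subnn take0; apply: tree_of_nil; lia.
have hs := @heightS b o ltac:(lia).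
rewrite subword_cons; last lia.
case bo : (nth false b o) hs => hs; last first.
  have no e : o <= e < o.+1 -> ~~ edge e.
    move=> he; have -> : e = o by lia.
    by apply/negP => /edge_letter; rewrite bo.
  case: hz => [yN|/inZ_subwordP[|h1 h2]]; [|lia|]; last first.
    by have := h1 o.+1; rewrite hs; lia.
  apply: (tree_of_skipl (z := o.+1)) => //; [lia|lia|].
  by apply: IH; [lia|lia|left].
have hyN : y != N -> height b y = height b o.
  by case: hz => [->|/(inZ_subwordP hoy)[]] //; rewrite eqxx.
have := @closes_spec b o y ltac:(lia) bo.
rewrite [tree_rec _ _ _ _]/=; set w := subword b o.+1 y; set s := o.+1 + zlen w.
move=> /= [sy hso hlow]; rewrite take_subword // -/s.
have vos : valid b m o.+1 s.
  apply/validP; split; [by rewrite /s; lia|move=> v hv|left].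
    by have := hlow v ltac:(lia); rewrite hs; lia.
  by rewrite hso hs.
have tz : tree_of o.+1 s (tree_rec m n o.+1 (subword b o.+1 s)).
  apply: IH; [by rewrite /s; lia|by rewrite /s; lia|right].
  by case/validP: vos => h1 h2 h3; apply/inZ_subwordP; [lia|split; [|rewrite hso hs]].
have lam e : o.+1 <= e < s -> edge e -> endp e <= s by apply: valid_laminar.
case: ifP => hc.
  case=> sy' hs1 bs.
  have [eo Eo] := @paired_edge o s.+1 ltac:(rewrite /s; lia) ltac:(move=> *; apply: hlow; lia) hs1.
  have -> : o + (zlen w).+2 = s.+1 by rewrite /s; lia.
  rewrite drop_subword ?addnS -/s; last by rewrite /s in sy'; lia.
  apply: tree_of_graft => //; rewrite ?Eo; [lia|lia| |  |].
  - apply/esym/negbTE/negP => /andP[/(longP _ m_gt0)[_ _ [r hr]] /eqP E].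
    by move: hr; rewrite -E hs1; lia.
  - apply: tree_of_skipr tz => //; [by rewrite /s; lia|lia|].
    move=> e he; have -> : e = s by lia.
    by apply/negP => /edge_letter; rewrite (negbTE bs).
  - apply: IH; [lia|by rewrite /s; lia|].
    case: hz => [->|/inZ_subwordP[|h1 h2]]; [by left|lia|right].
    apply/inZ_subwordP; [lia|split; last by rewrite hs1].
    by move=> v hv; rewrite hs1; apply: h1; rewrite /s in hv *; lia.
case=> bs hhigh.
have hh v : o < v <= y -> (height b o < height b v)%R.
  move=> hv; case: (leqP v s) => vs; first by apply: hlow; lia.
  by have := hhigh v ltac:(lia); rewrite hso; lia.
have yN : y = N by apply/eqP; apply: contraT => /hyN E; have := hh y ltac:(lia); rewrite E ltxx.
subst y.
have -> : ~~ false + unpaired_ones w = unpaired_ones (drop o b).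
  by rewrite -subword_drop (@subword_cons b o) ?bo -/w /= ?hc //; lia.
have hj : height b N = (height b o + (unpaired_ones (drop o b))%:Z)%R.
  apply: unpaired_ones_above => [|u hu]; first lia.
  by case: (ltngtP o u) hu => [ou|uo|<-] hu; [apply/ltW/hh; lia|lia|].
move: (unpaired_ones _) hj => j hj.
have [eoE Eo longo] := unpaired_edge oy hh hj; clear hyN hz hlow.
have tN : tree_of N N Root by apply: tree_of_nil; lia.
case: leqP => hjm.
  have eo : edge o by rewrite eoE; move: hjm; clear; lia.
  have {}Eo := Eo eo; apply: tree_of_graft => //; rewrite ?Eo //.
    by rewrite longo eqxx andbT; case: (ltngtP j m) hjm => // -> _; rewrite subnn.
  by apply: IH; [lia|lia|left].
case: ifP => hodd; rewrite hodd (ltnNge j) (ltnW hjm) /= in eoE.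
  apply: (tree_of_skipl (z := o.+1)) => //; [by rewrite leqnSn| |by apply: IH; [lia|lia|left]].
  move=> e he; have -> : e = o by lia.
  by rewrite eoE.
have eo : edge o by rewrite eoE.
have {}Eo := Eo eo.
(* Since [j > m >= 1], a second unpaired 1 exists, so the Z-word after the first one stops before
   the end. *)
have sN : s < N.
  by case: (ltngtP s N) => // E; [lia|move: hj; rewrite -E hso; lia].
have -> : o + (zlen w).+2 = s.+1 by rewrite /s; lia.
rewrite drop_subword ?addnS -/s; last by rewrite /s in sN; lia.
apply: tree_of_graft => //; rewrite ?Eo ?longo ?eqxx ?hodd ?(ltnW hjm) //.
apply: tree_of_cat tz _ => //; first by rewrite /s; lia.
(* The second 1 of the pair has number [j.-1], at odd distance from [m], so it carries no edge and
   is skipped. *)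
apply: (tree_of_skipl (z := s.+1)); [lia|lia| |by apply: IH; [lia|rewrite /s; lia|left]].
move=> e he; have -> : e = s by lia.
have [|-> _ _] := unpaired_edge (j := j.-1) sN hhigh; first by rewrite hj hso; lia.
by case: (j) hjm hodd => // k hk; rewrite subSn //=; lia.
Qed.

Lemma tree_of_tree : tree_of 0 N (tree m b).
Proof.
have := @tree_rec_of N 0 N; rewrite subword_drop drop0.
by apply; [lia|lia|left].
Qed.

End Tree.

(** * Precedence *)

Lemma child_edges_sub t x y : (x, y) \in child_edges t -> y \in edges t.
Proof.
elim: t => //= e p s IHs t IHt; rewrite mem_cat inE !mem_cat.
case/orP => [/mapP[z /root_edges_sub hz [_ ->]]|]; first by rewrite hz orbT.
by case/orP => [/IHs->|/IHt->]; rewrite !orbT.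
Qed.

Lemma infix_filter_iota (P : pred nat) i n e f : i <= e -> e < f -> f < i + n ->
  P e -> P f -> (forall g, e < g < f -> ~~ P g) ->
  infix [:: e; f] [seq k <- iota i n | P k].
Proof.
move=> h1 h2 h3 pe pf H.
have -> : n = (e - i) + ((f - e) + (i + n - f)) by lia.
rewrite !iotaD !filter_cat; apply/infixP; rewrite subnKC //.
exists [seq k <- iota i (e - i) | P k], [seq k <- iota f.+1 (i + n - f).-1 | P k].
congr (_ ++ _); have -> : e + (f - e) = f by lia.
have -> : [seq k <- iota e (f - e) | P k] = [:: e].
  have -> : f - e = (f - e.+1).+1 by lia.
  rewrite /= pe; congr cons; apply/eqP; rewrite -[_ == _]negbK -has_filter.
  by apply/hasPn => g; rewrite mem_iota => hg; apply: H; lia.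
by case E : (i + n - f) => [|k]; [lia|rewrite /= pf].
Qed.

Lemma infix_sorted_lt (s : seq nat) e f : sorted ltn s -> infix [:: e; f] s ->
  [/\ e \in s, f \in s & e < f].
Proof.
move=> hs /infixP[s1 [s2 E]]; subst s; move: hs.
rewrite sorted_pairwise; last exact: ltn_trans.
rewrite pairwise_cat => /and3P[_ _] /= /andP[/andP[h _] _].
by rewrite !mem_cat !inE !eqxx !orbT.
Qed.

Section Precedence.
Variables (b : seq bool) (m : nat).
Hypothesis m_gt0 : 0 < m.
Notation edge := (edge b m).
Notation endp := (endp b m).
Notation long := (long b m).
Notation N := (size b).
Notation h := (height b).

Lemma prec_blockP i j : prec_block m b i j ->
  [/\ i < j < N, forall v, i <= v <= N -> (h i <= h v)%R, h j = h i & long j].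
Proof.
case/and4P => lij hz _ /hasP[r _ hr].
have jN : j < N.
  rewrite ltnNge; apply/negP => jN; move: hr; rewrite drop_oversize //.
  have : 0 < m + r.*2 by rewrite addn_gt0 m_gt0.
  by case: (m + r.*2).
move: hz => /inZ_subwordP[|z1 z2]; first lia.
move: hr => /(one_blocksP _ (ltnW jN))[o1 o2].
split => //; [lia| |].
  move=> v hv; case: (leqP v j) => vj; first by apply: z1; lia.
  by rewrite -z2; apply/ltW/o1; lia.
apply/longP => //; split => //; last by exists r.
by move=> v; case: (ltngtP j v) => [jv|//|->] hv //; apply/ltW/o1; lia.
Qed.

Lemma prec_block_endp i j : prec_block m b i j -> endp j = N.
Proof.
move=> hb; have [hij _ _ /(long_edge m_gt0)/endpP[e1 _ _ e4]] := prec_blockP hb.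
case/and4P: hb => _ _ _ /hasP[r _ /one_blocksP[|o1 _]]; first lia.
by case: e4 => [E|[]//]; have := o1 (endp j) ltac:(lia); rewrite E ltxx.
Qed.

Lemma mem_factor_starts i j k : prec_block m b i j ->
  (k \in factor_starts b i j) = (i <= k <= j) && (h k == h i).
Proof.
move=> /prec_blockP[hij H _ _]; rewrite mem_filter mem_iota.
have -> : i + (j - i).+1 = j.+1 by lia.
rewrite ltnS; case: (boolP (i <= k <= j)) => hk; rewrite ?andbF // andbT.
rewrite inZ_subword; last lia.
suff -> : above b i k by [].
by apply/aboveP => [|v hv]; [|apply: H]; lia.
Qed.

Lemma sorted_factor_starts i j : sorted ltn (factor_starts b i j).
Proof. by apply: sorted_filter (iota_ltn_sorted _ _); exact: ltn_trans. Qed.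

Lemma imm_precedes_block f e : imm_precedes m b f e ->
  e < f /\ exists i j, [/\ prec_block m b i j, i <= e < j & h e = h i].
Proof.
case/existsP => i /existsP[j /andP[hb /(infix_sorted_lt (sorted_factor_starts _ _))]].
rewrite !mem_factor_starts // => -[/andP[he /eqP Ee] /andP[hf _] ef].
by split => //; exists i, j; split => //; lia.
Qed.

Lemma block_long i j e : prec_block m b i j -> i <= e <= j -> h e = h i -> long e.
Proof.
move=> /prec_blockP[hij H Ej /(longP _ m_gt0)[jN _ [r hr]]] he Ee.
apply/longP => //; split; [lia| |by exists r; rewrite hr Ej Ee].
by move=> v hv; rewrite Ee; apply: H; lia.
Qed.

(** The indecomposable factors of a block are cut at its returns to the base height. So the interval
    of the maximal edge of a factor ends where the next factor, or w'', starts. *)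
Lemma imm_precedes_endp i j e : prec_block m b i j -> i <= e < j -> h e = h i ->
  [/\ endp e <= j, h (endp e) = h i & imm_precedes m b (endp e) e].
Proof.
move=> hb he Ee; have [hij H Ej _] := prec_blockP hb.
have vej : valid b m e j.
  apply/validP; split; [lia| |by left; rewrite Ej Ee].
  by move=> v hv; rewrite Ee; apply: H; lia.
have lej : e < j by lia.
have ee := valid_edge lej vej; have Eej := endp_le lej vej.
have [e1 e2 e3 e4] := endpP ee.
have Ehe : h (endp e) = h i by case: e4 => [->//|]; lia.
split => //.
apply/existsP; exists (Ordinal (ltac:(lia) : i < N)).
apply/existsP; exists (Ordinal (ltac:(lia) : j < N)) => /=; rewrite hb /=.
have memfs k : i <= k <= j -> inZ (subword b i k) = (h k == h i).
  move=> hk; have := mem_factor_starts k hb.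
  rewrite mem_filter mem_iota hk.
  have -> : (i <= k < i + (j - i).+1) by lia.
  by rewrite andbT.
apply: infix_filter_iota; [lia|lia|lia| | |].
- by rewrite memfs ?Ee //; lia.
- by rewrite memfs ?Ehe //; lia.
- move=> g hg; rewrite memfs; last lia.
  by have := e3 g hg; rewrite Ee; case: eqP => // ->; rewrite ltxx.
Qed.

(** The block ends at the last vertex [j] at the height of [x] and starts at the smallest [i] from
    which a Z-word leads to [j]; the path after [j] stays above that height. *)
Lemma long_block x : long x -> endp x < N ->
  exists i j, [/\ prec_block m b i j, i <= x < j & h x = h i].
Proof.
move=> lx eN; have [xN H [r hr]] := longP _ m_gt0 _ lx.
have ex := long_edge m_gt0 lx; have [e1 e2 e3 e4] := endpP ex.
have Ex : h (endp x) = h x by case: e4 => // -[]; lia.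
pose P v := (v <= N) && (h v == h x).
have exP : exists v, P v by exists x; rewrite /P eqxx; lia.
have bndP v : P v -> v <= N by case/andP.
case: (ex_maxnP exP bndP) => j /andP[jN /eqP Ej] jmax.
have xj : endp x <= j by apply: jmax; rewrite /P Ex eqxx; lia.
pose Q v := (v <= j) && inZ (subword b v j).
have Qx : Q x.
  rewrite /Q; apply/andP; split; first lia.
  apply/inZ_subwordP; first lia.
  by split => // v hv; apply: H; lia.
case: (ex_minnP (ex_intro _ x Qx)) => i /andP[ij zi] imin.
have ix := imin x Qx.
have [z1 z2] := inZ_subwordP (ltac:(lia) : i <= j <= N) zi.
exists i, j; split; [|lia|by rewrite -Ej].
have jN' : j < N by rewrite ltn_neqAle jN andbT; apply/eqP => E; move: hr; rewrite -E Ej; lia.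
apply/and4P; split => //; first lia.
  apply/allP => v; rewrite mem_iota => hv; apply/negP => hz.
  by have := imin v; rewrite /Q hz andbT; lia.
apply/hasP; exists r.
  (* In [prec_block] the number r ranges below the length of the string; the crude bounds -u <= h u
     <= u place it there. *)
  rewrite mem_iota /=; have Hs u : u <= N -> (h u <= u%:Z)%R.
    elim: u => [|u IH] hu; first by rewrite height0.
    by rewrite heightS //; have := IH (ltnW hu); case: nth; lia.
  have Hl u : u <= N -> (- u%:Z <= h u)%R.
    elim: u => [|u IH] hu; first by rewrite height0.
    by rewrite heightS //; have := IH (ltnW hu); case: nth; lia.
  by have := Hs N; have := Hl x; lia.
apply/one_blocksP => //; split; last by rewrite hr Ej.
move=> v hv; rewrite lt_neqAle Ej H; last lia.
rewrite andbT; apply/eqP => E; have := jmax v; rewrite /P -E eqxx; lia.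
Qed.

End Precedence.

(** * Profiles and labellings *)

Section Profiles.
Variables (m : nat) (a b : seq bool).
Notation edge := (edge b m).
Notation endp := (endp b m).
Notation long := (long b m).
Notation N := (size b).
Notation h := (height b).

(* The number of boxes of the region at abscissa [i]. *)
Definition depth i := ones (take i a) - ones (take i b).

Definition covers (c : nat -> nat) k x := forall p, x <= p < N -> k < c p.

Definition spanned (c : nat -> nat) := forall p k, k < c p ->
  exists e, [/\ edge e, e <= p < endp e & forall q, e <= q < endp e -> k < c q].

(* [c p] stands for the number of layers in which the letter [p] lies inside *)
(* a strip; [profile_even] says that the number of layers whose last strip    *)
(* contains the suffix from [x] on is even.                                   *)
Record profile (c : nat -> nat) : Prop := Profile {
  profile_span : spanned c;
  profile_depth : forall p, (c p <= depth p) && (c p <= depth p.+1);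
  profile_even : forall x y k, x <= y -> long y -> ~~ odd k ->
    covers c k x -> covers c k.+1 x }.

(** The edge that covers a letter in layer [k] has its whole interval covered in that layer, so it
    cannot cross an end of a maximal run. The run is therefore a union of edge intervals. *)
Lemma run_valid (c : nat -> nat) x y k : spanned c ->
  x <= y <= N -> (forall p, x <= p < y -> k < c p) ->
  (0 < x -> c x.-1 <= k) -> (y < N -> c y <= k) -> valid b m x y.
Proof.
move=> span hxy run hx hy; apply: valid_union => // p hp.
have [e [ee he H]] := span _ _ (run p hp); have [e1 _ _ _] := endpP ee.
exists e; split => //; [|lia|].
  apply/andP; split; last lia.
  rewrite leqNgt; apply/negP => ex.
  by have := H x.-1 ltac:(lia); rewrite ltnNge hx //; lia.
rewrite leqNgt; apply/negP => ey.
by have := H y ltac:(lia); rewrite ltnNge hy //; lia.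
Qed.

(** Otherwise layer [c p] would cover [e] by an edge interval, which by laminarity would contain [p]
    as well. *)
Lemma profile_edge c e p : profile c -> edge e -> e <= p < endp e -> c e <= c p.
Proof.
move=> pc ee hp; rewrite leqNgt; apply/negP => lt.
have [e' [ee' he' H]] := profile_span pc lt.
have := edge_laminar ee' (e := e) ltac:(lia) ee => le.
by have := H p ltac:(lia); rewrite ltnn.
Qed.

Lemma profile_le_size c p : profile c -> c p <= size a.
Proof.
move=> pc; have /andP[hc _] := profile_depth pc p; apply: leq_trans hc _.
rewrite /depth; apply: leq_trans (leq_subr _ _) _.
by apply: leq_trans (count_size _ _) _; rewrite size_take_min geq_minr.
Qed.

Hypothesis m_gt0 : 0 < m.

(** Let [x0] be the leftmost vertex from which layer [k] covers the suffix. The maximal run from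
    [x0] is a valid word, and it is long because it contains a long one. *)
Lemma profile_even_of_long (c : nat -> nat) : spanned c ->
  (forall x k, long x -> ~~ odd k -> covers c k x -> covers c k.+1 x) ->
  forall x y k, x <= y -> long y -> ~~ odd k -> covers c k x -> covers c k.+1 x.
Proof.
move=> span even x y k xy ly ek hk.
have [yN _ _] := longP _ m_gt0 _ ly.
pose P v := (v <= N) && all (fun p => k < c p) (iota v (N - v)).
have PP v : P v -> v <= N /\ covers c k v.
  case/andP => vN /allP H; split => // p hp; apply: H; rewrite mem_iota; lia.
have Px : P x.
  apply/andP; split; first lia.
  by apply/allP => p; rewrite mem_iota => hp; apply: hk; lia.
case: (ex_minnP (ex_intro _ x Px)) => x0 /[dup] Px0 /PP[x0N hx0] xmin.
have x0x := xmin x Px.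
have v0 : valid b m x0 N.
  apply: (run_valid (k := k)) span _ _ _ _; [lia|exact: hx0| |lia].
  move=> x00; rewrite leqNgt; apply/negP => hc.
  have := xmin x0.-1; rewrite /P.
  have -> : N - x0.-1 = (N - x0).+1 by lia.
  by rewrite /= hc prednK //; case/andP: Px0 => _ ->; lia.
have lx0 : long x0 by apply: long_left ly => //; lia.
by move=> p hp; apply: (even x0) => //; lia.
Qed.

Hypothesis size_ab : size a = size b.

(** * Depth of the region and the peaks of [b] *)

Lemma depth_one i : nth false b i -> depth i.+1 <= depth i.
Proof.
move=> bi; have iN : i < N.
  by rewrite ltnNge; apply/negP => /(nth_default false) E; rewrite E in bi.
rewrite /depth (take_nth false iN) (take_nth false) ?size_ab // -!cats1 /ones !count_cat /=.
by rewrite bi; case: nth; lia.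
Qed.

Lemma depth_two i : i < N -> ~~ nth false b i -> depth i <= depth i.+1.
Proof.
move=> iN bi.
rewrite /depth (take_nth false iN) (take_nth false) ?size_ab // -!cats1 /ones !count_cat /=.
by rewrite (negbTE bi); case: nth; lia.
Qed.

Lemma endp_letter e : edge e -> endp e < N -> ~~ nth false b (endp e).-1.
Proof.
move=> ee eN; have [e1 e2 e3 e4] := endpP ee; have E : (endp e).-1.+1 = endp e by lia.
have := @heightS b (endp e).-1 ltac:(lia); rewrite E; case: nth => // H.
by have := e2 (endp e).-1 ltac:(lia); case: e4 => [|[]]; lia.
Qed.

Lemma low_peak_right e v : edge e -> e <= v < endp e -> nth false b v ->
  exists f, [/\ e <= f < endp e, peak b f & depth f.+1 <= depth v].
Proof.
move=> ee; have [e1 e2 e3 e4] := endpP ee.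
move: {2}(endp e - v) (leqnn (endp e - v)) => n; elim: n v => [|n IH] v hn hv bv; first lia.
case: (boolP (peak b v)) => pv; first by exists v; split => //; apply: depth_one.
move: pv; rewrite /peak bv /= negb_or negbK => /andP[vN bv1].
have hv1 : v.+1 < endp e.
  rewrite ltnNge; apply/negP => hv1; have E : endp e = v.+1 by lia.
  by have := endp_letter ee; rewrite E bv /= => /(_ ltac:(lia)).
have [f [f1 f2 f3]] := IH v.+1 ltac:(lia) ltac:(lia) bv1.
by exists f; split => //; apply: leq_trans f3 (depth_one bv).
Qed.

(** The depth never grows along a 1 of [b] and never drops along a 2. So walking right through 1's,
    or left through 2's, reaches a peak that is no deeper, without leaving the interval of [e]. *)
Lemma low_peak e v : edge e -> e <= v <= endp e ->
  exists f, [/\ e <= f < endp e, peak b f & depth f.+1 <= depth v].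
Proof.
move=> ee; have [e1 e2 e3 e4] := endpP ee; have be := edge_letter ee.
elim: v => [|v IH] hv.
  have E : e = 0 by lia.
  by subst e; apply: low_peak_right be; lia.
case: (ltngtP v.+1 e) => [|ev|E]; [lia| |subst e]; last by apply: low_peak_right be; lia.
case bv : (nth false b v); last first.
  have [|f [f1 f2 f3]] := IH; first lia.
  by exists f; split => //; apply: leq_trans f3 (depth_two _ (negbT bv)); lia.
case bv1 : (nth false b v.+1).
  case: (ltnP v.+1 (endp e)) => hv1; first by apply: low_peak_right bv1; lia.
  have E : endp e = v.+1 by lia.
  have := endp_letter ee; rewrite E bv /= => hN.
  exists v; split => //; first lia.
  by rewrite /peak bv /=; case: (ltngtP v.+1 N) hN => // [_ /(_ isT)//|]; lia.
exists v; split => //; first lia.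
by rewrite /peak bv bv1 orbT.
Qed.

Notation eT := (edge_type m b).
Notation labels := (labels m a b).

Lemma edge_typeP (e : eT) : edge (val e).
Proof.
have := valP e; have [te _ _ _ _] := tree_of_tree b m_gt0.
by rewrite /= te => /andP[].
Qed.

Lemma edge_typeK x : edge x -> exists e : eT, val e = x.
Proof.
move=> ex; have [te _ _ _ _] := tree_of_tree b m_gt0.
have hx : x \in edges (tree m b) by rewrite te ex andbT (edge_lt ex).
by exists (SeqSub hx).
Qed.

Lemma precedes_lt (f e : eT) : precedes f e -> val e < val f.
Proof.
case/existsP => g /andP[/imm_precedes_block[//|gf _]].
case/connectP => p; elim: p g gf => [|x p IH] g gf /=; first by move=> _ ->.
case/andP => /imm_precedes_block[//|xg _] pp E.
exact: IH (ltn_trans xg gf) pp E.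
Qed.

Lemma precedes_trans (f g e : eT) :
  imm_precedes m b (val f) (val g) -> precedes g e -> precedes f e.
Proof.
move=> fg /existsP[g' /andP[gg' ge]]; apply/existsP; exists g; rewrite /= fg /=.
exact: connect_trans (connect1 gg') ge.
Qed.

Lemma precedes_last (f e : eT) : precedes f e ->
  exists g : eT, imm_precedes m b (val g) (val e).
Proof.
case/existsP => g /andP[fg /connectP[p]]; case/lastP: p => [_ ->|p x].
  by exists f.
by rewrite rcons_path last_rcons => /andP[_ hx] ->; exists (last g p).
Qed.

Lemma imm_precedesW (f e : eT) : imm_precedes m b (val f) (val e) -> precedes f e.
Proof. by move=> h1; apply/existsP; exists e; rewrite /= h1 connect0. Qed.

(** * From labellings to profiles *)

Section FromLabels.
Variable nu : labels.
Hypothesis lab : labelling nu.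

Definition label_at x := if insub x is Some e then val (nu e) else 0.

Lemma label_atE (e : eT) : label_at (val e) = nu e.
Proof. by rewrite /label_at valK. Qed.

Lemma labelling_mono (e e' : eT) : val e < val e' < endp (val e) -> nu e <= nu e'.
Proof.
move=> he; rewrite -!label_atE; apply: (child_desc (t := tree m b)); last first.
  have [_ td _ _ _] := tree_of_tree b m_gt0.
  by apply: td => //; try exact: edge_typeP; have := edge_lt (edge_typeP e).
move=> x y hxy; rewrite /label_at.
case: insubP => // x' hx Ex; case: insubP => [y' hy Ey|]; last first.
  by rewrite (child_edges_sub hxy).
case/and4P: lab => _ /forallP/(_ x')/forallP/(_ y')/implyP + _ _.
by rewrite Ex Ey => /(_ hxy).
Qed.

(** The capacity of a leaf edge [f] is [depth f.+1]. Labels grow towards the leaves, and some peak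
    in the interval of [e] has capacity at most [depth v]. *)
Lemma labelling_depth (e : eT) v : val e <= v <= endp (val e) -> nu e <= depth v.
Proof.
move=> hv; have [f [f1 f2 f3]] := low_peak (edge_typeP e) hv.
have [ef _] := peak_edge m_gt0 f2; have [f' Ef] := edge_typeK ef; subst f.
apply: leq_trans f3; apply: (@leq_trans (nu f')).
  case: (ltngtP (val e) (val f')) => [lt|lt|/val_inj -> //]; last lia.
  by apply: labelling_mono; lia.
case/and4P: lab => /forallP/(_ f')/implyP + _ _ _; apply.
have [_ _ _ tl _] := tree_of_tree b m_gt0.
by apply: tl => //; apply: edge_lt ef.
Qed.

Definition label_profile p := \max_(e : eT | val e <= p < endp (val e)) nu e.

Lemma label_profile_ge (e : eT) p : val e <= p < endp (val e) -> nu e <= label_profile p.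
Proof. by move=> he; apply: (@leq_bigmax_cond _ _ (fun e : eT => val (nu e)) e). Qed.

Lemma label_profile_edge (e : eT) : label_profile (val e) = nu e.
Proof.
apply/eqP; rewrite eqn_leq label_profile_ge ?leqnn ?lt_endp // andbT.
apply/bigmax_leqP => f hf; case: (ltngtP (val f) (val e)) => [lt|lt|/val_inj->//]; last lia.
by apply: labelling_mono; lia.
Qed.

Lemma label_profile_gt p k : k < label_profile p ->
  exists2 e : eT, val e <= p < endp (val e) & k < nu e.
Proof.
move=> hk; apply/exists_inP; apply: contraLR hk => /exists_inPn H.
by rewrite -leqNgt; apply/bigmax_leqP => e he; rewrite leqNgt H.
Qed.

Lemma label_profile_span : spanned label_profile.
Proof.
move=> p k /label_profile_gt[e he hk]; exists (val e); split => //; first exact: edge_typeP.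
by move=> q hq; apply: leq_trans hk (label_profile_ge hq).
Qed.

(** Induction from right to left. If the interval of [x] reaches the end, its edge is marked + and
    has an even label. Otherwise [endp x] is long again, and by the claim there an odd label [k.+1]
    on [x] would exceed no preceding label, against condition (4). *)
Lemma label_profile_long x k : long x -> ~~ odd k ->
  covers label_profile k x -> covers label_profile k.+1 x.
Proof.
move: {2}(N - x) (leqnn (N - x)) => n; elim: n x => [|n IH] x hn lx ek hk.
  by have [] := longP _ m_gt0 _ lx; lia.
have ex := long_edge m_gt0 lx; have [e Ee] := edge_typeK ex; subst x.
have [xN H [r hr]] := longP _ m_gt0 _ lx.
have [e1 e2 e3 e4] := endpP ex.
have hke : k < nu e by rewrite -label_profile_edge; apply: hk; lia.
have big p : k.+1 < nu e -> val e <= p < endp (val e) -> k.+1 < label_profile p.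
  by move=> he hp; apply: leq_trans he (label_profile_ge hp).
case: (ltngtP (endp (val e)) N) => [eN|//|eN]; last 2 first.
- lia.
- move=> p hp; apply: big; last by rewrite eN.
  have : ~~ odd (nu e).
    case/and4P: lab => _ _ /forallP/(_ e)/implyP + _; apply.
    by have [_ _ _ _ ->] := tree_of_tree b m_gt0; rewrite lx eN eqxx xN.
  by case: (ltngtP (k.+1) (nu e)) hke => // E; rewrite -E /= ek.
have Eh : h (endp (val e)) = h (val e) by case: e4 => // -[]; lia.
have lend : long (endp (val e)).
  apply/longP => //; split => //; last by exists r; rewrite Eh.
  by move=> v hv; rewrite Eh; apply: H; lia.
have hend : covers label_profile k.+1 (endp (val e)).
  apply: IH => //; first by move: hn e1; clear; lia.
  by move=> p /andP[hp pN]; apply: hk; rewrite pN (leq_trans _ hp) // ltnW ?lt_endp.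
suff he : k.+1 < nu e.
  move=> p hp; case: (ltnP p (endp (val e))) => hpe.
    by apply: big => //; case/andP: hp => ->.
  by apply: hend; case/andP: hp => _ ->; rewrite hpe.
rewrite ltn_neqAle hke andbT; apply/eqP => Ek.
have [i [j [hb hij Ehi]]] := long_block m_gt0 lx eN.
have [_ _ himm] := imm_precedes_endp m_gt0 hb hij Ehi.
have [f Ef] := edge_typeK (long_edge m_gt0 lend).
case/and4P: lab => _ _ _ /forallP/(_ e)/implyP; rewrite -Ek /= ek => Hp.
apply: notF; apply: Hp.
apply/andP; split; first by apply/existsP; exists f; apply: imm_precedesW; rewrite Ef.
(* Preceding edges lie to the right of [e]: inside its interval monotonicity bounds them, beyond it
   the induction hypothesis does. *)
apply/forallP => g; apply/implyP => /precedes_lt eg.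
case: (ltnP (val g) (endp (val e))) => hg.
  by rewrite Ek; apply: labelling_mono; rewrite eg hg.
by rewrite -label_profile_edge; apply/ltnW/hend; rewrite hg (edge_lt (edge_typeP g)).
Qed.

Lemma label_profileP : profile label_profile.
Proof.
split.
- exact: label_profile_span.
- move=> p; apply/andP; split; apply/bigmax_leqP => e he; apply: labelling_depth; lia.
- exact: profile_even_of_long label_profile_span label_profile_long.
Qed.

End FromLabels.

(** * From profiles to labellings *)

Definition profile_labels (c : nat -> nat) : labels := [ffun e => inord (c (val e))].

Lemma profile_labelsE c e : profile c -> profile_labels c e = c (val e) :> nat.
Proof. by move=> pc; rewrite ffunE inordK // ltnS profile_le_size. Qed.

(** For the parity conditions: if the label in question were odd, say [k.+1], layer [k] would cover
    the whole suffix from that edge on, and by [profile_even] so would layer [k.+1], exceeding the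
    label. *)
Lemma profile_labelling c : profile c -> labelling (profile_labels c).
Proof.
move=> pc; have [te td tc tl tp] := tree_of_tree b m_gt0.
apply/and4P; split; apply/forallP => e; rewrite ?profile_labelsE //.
- by apply/implyP => _; have /andP[] := profile_depth pc (val e).
- apply/forallP => e'; apply/implyP => /tc he; rewrite !profile_labelsE //.
  apply: profile_edge => //; first exact: edge_typeP.
  by case/andP: he => /ltnW -> ->.
- apply/implyP; rewrite tp => /and3P[_ le /eqP Ee].
  case E : (c (val e)) => [//|k] /=; rewrite negbK; apply/negPn/negP => ek.
  have hk : covers c k (val e).
    move=> p hp; rewrite -E; apply: profile_edge => //; first exact: edge_typeP.
    by rewrite Ee.
  have := profile_even pc (leqnn _) le ek hk (p := val e).
  by rewrite E ltnn (edge_lt (edge_typeP e)) leqnn => /(_ isT).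
apply/implyP => /andP[/existsP[f /precedes_last[g himm]] /forallP hle].
have [_ [i [j [hb hij Ehi]]]] := imm_precedes_block m_gt0 himm.
(* Runs through the factor starts from [e] to the end [j] of the block. Each later one precedes [e],
   so its label is no smaller, and the interval of [j] reaches the end of the string. *)
have up x : val e <= x <= j -> h x = h i -> c (val e) <= c x ->
    x = val e \/ (exists2 g : eT, val g = x & precedes g e) ->
    forall p, x <= p < N -> c (val e) <= c p.
  move: {2}(j - x) (leqnn (j - x)) => n; elim: n x => [|n IH] x hn hx Ex hc hpx p hp.
    have E : x = j by lia.
    subst x; apply: leq_trans hc _; apply: profile_edge; rewrite ?(prec_block_endp m_gt0 hb) //.
    by apply: long_edge m_gt0 _ _; apply: block_long hb _ Ex => //; lia.
  case: (ltngtP x j) => xj; [|lia|]; last by apply: (IH x) => //; lia.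
  have ex : edge x by apply: long_edge m_gt0 _ _; apply: block_long hb _ Ex => //; lia.
  case: (ltnP p (endp x)) => hpe.
    by apply: leq_trans hc _; apply: profile_edge => //; lia.
  have [yj Ey himmy] := imm_precedes_endp m_gt0 hb (ltac:(lia) : i <= x < j) Ex.
  have xy := lt_endp b m x.
  have ey : edge (endp x) by apply: long_edge m_gt0 _ _; apply: block_long hb _ Ey => //; lia.
  have [y' Ey'] := edge_typeK ey; have pye : precedes y' e.
    case: hpx => [E|[z Eg hg]]; first by apply: imm_precedesW; rewrite Ey' -E.
    by apply: precedes_trans hg; rewrite Ey' Eg.
  apply: (IH (endp x)) => //;
    [by move: hn xy; clear; lia|by move: hx xy yj; clear; lia| | |by move: hp hpe; clear; lia].
  - by have := hle y'; rewrite pye /= profile_labelsE // Ey'.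
  - by right; exists y'.
case E : (c (val e)) => [//|k] /=; rewrite negbK; apply/negPn/negP => ek.
have := profile_even pc (leqnn _) (block_long m_gt0 hb (ltac:(lia) : i <= val e <= j) Ehi) ek.
have hc : covers c k (val e).
  by move=> p hp; rewrite -E; apply: (up (val e)) => //; [lia|left].
move=> /(_ hc (val e)); rewrite E ltnn (edge_lt (edge_typeP e)) leqnn => /(_ isT).
by [].
Qed.

Lemma label_profileK (nu : labels) : labelling nu -> profile_labels (label_profile nu) = nu.
Proof.
move=> lab; apply/ffunP => e; apply: ord_inj.
by rewrite profile_labelsE ?label_profile_edge //; apply: label_profileP.
Qed.

Lemma profile_labelsK c p : profile c -> label_profile (profile_labels c) p = c p.
Proof.
move=> pc; apply/eqP; rewrite eqn_leq; apply/andP; split.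
  apply/bigmax_leqP => e he; rewrite profile_labelsE //.
  by apply: profile_edge => //; apply: edge_typeP.
case E : (c p) => [//|k].
have [e [ee he H]] := profile_span pc (ltac:(lia) : k < c p).
have [e' Ee] := edge_typeK ee; subst e.
apply: leq_trans (label_profile_ge _ he); rewrite profile_labelsE //; apply: H.
by rewrite leqnn lt_endp.
Qed.

End Profiles.

(** * Weights *)

Section EdgeCount.
Variables (b : seq bool) (m : nat).
Hypothesis m_gt0 : 0 < m.
Notation edge := (edge b m).
Notation endp := (endp b m).
Notation N := (size b).
Notation h := (height b).

Definition edge_count x y : nat := \sum_(x <= i < y) edge i.

(** The 1 at [p] is closed by the first later vertex not above it, which exists because [y] is such
    a vertex. *)
Lemma letter_edge x y p : x <= p < y -> y <= N ->
  (forall v, x <= v <= y -> (h x <= h v)%R) -> h y = h x ->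
  nth false b p -> edge p.
Proof.
move=> hp yN H Ey bp.
pose Q v := (p < v <= N) && (h v <= h p)%R.
have Qy : Q y by rewrite /Q Ey H; lia.
case: (ex_minnP (ex_intro _ y Qy)) => v /andP[pv hv] vmin.
have hlow u : p < u < v -> (h p < h u)%R.
  by move=> hu; rewrite ltNge; apply/negP => hu'; have := vmin u; rewrite /Q hu'; lia.
have Ev : h v = h p.
  case: v pv hv vmin hlow => [|v] pv hv vmin hlow; first lia.
  have := @heightS b v ltac:(lia).
  case: (ltngtP p v) => ppv; [|lia|].
    by have := hlow v ltac:(lia); case: nth; lia.
  by subst v; rewrite bp; lia.
by have [] := paired_edge m_gt0 pv hlow Ev.
Qed.

Lemma edge_count_Z x y : x <= y <= N ->
  (forall v, x <= v <= y -> (h x <= h v)%R) -> h y = h x ->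
  (edge_count x y).*2 = y - x.
Proof.
move=> hxy H E; have := letter_count hxy; rewrite E addrK => -[<-].
congr (_.*2); apply: eq_big_nat.
move=> i hi; congr nat_of_bool; apply/idP/idP => [|bi]; first exact: edge_letter.
by apply: (letter_edge (x := x) (y := y)) => //; case/andP: hxy.
Qed.

Lemma edge_count_cat x z y : x <= z <= y ->
  edge_count x y = edge_count x z + edge_count z y.
Proof. by move=> hz; rewrite /edge_count (@big_cat_nat _ _ _ z) //=; lia. Qed.

(** Each paired 1 carries an edge; an unpaired 1 does iff its number is at most [m] or at even
    distance from [m]. So [j > m] unpaired 1's carry m + floor((j - m) / 2) edges, and doubling
    gives [m + j - odd (j - m)]. *)
Lemma edge_count_suffix x l j : x + l.*2 + j = N ->
  (forall v, x <= v <= N -> (h x <= h v)%R) -> h N = (h x + j%:Z)%R ->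
  (edge_count x N).*2 = l.*2 + (if j <= m then j.*2 else m + j - odd (j - m)).
Proof.
move: {2}(N - x) (leqnn (N - x)) => n; elim: n x l j => [|n IH] x l j hn hN H hj.
  have -> : j = 0 by lia.
  have -> : l = 0 by lia.
  by rewrite /edge_count big_geq //; lia.
have [xN|xN] : x = N \/ x < N by lia.
  have -> : j = 0 by lia.
  have -> : l = 0 by lia.
  by rewrite /edge_count big_geq //; lia.
have bx : nth false b x.
  have := H x.+1 ltac:(lia); rewrite heightS //; case: nth => //; lia.
(* A later return to the height of [x] splits off a Z-word; without one, the letter at [x] is an
   unpaired 1 and is peeled off. *)
case: (boolP (has (fun v => h v == h x) (iota x.+1 (N - x)))) => [/hasP[v + /eqP Ev]|/hasPn Hx].
  rewrite mem_iota => hv; have hxv : x <= v <= N by lia.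
  rewrite (edge_count_cat hxv) doubleD edge_count_Z //; last first.
    by move=> w hw; apply: H; lia.
  have := letter_count hxv; rewrite Ev => hl.
  have [q Eq] : exists q, v = x + q.*2.
    by exists (\sum_(x <= i < v) nth false b i); lia.
  have hql : q <= l by have := @height_growth b v N ltac:(lia); rewrite Ev hj; lia.
  rewrite (IH v (l - q) j) ?Ev //; [lia|lia|lia|].
  by move=> w hw; apply: H; lia.
have Hx' v : x < v <= N -> (h x < h v)%R.
  move=> hv; rewrite lt_neqAle H ?andbT; last lia.
  by rewrite eq_sym; apply: Hx; rewrite mem_iota; lia.
have [eE _ _] := unpaired_edge m_gt0 xN Hx' hj.
have hx1 := heightS xN; rewrite bx in hx1.
have j0 : 0 < j by have := Hx' N; lia.
have hxx : x <= x.+1 <= N by lia.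
have H1 v : x.+1 <= v <= N -> (h x.+1 <= h v)%R.
  by move=> hv; have := Hx' v ltac:(lia); rewrite hx1; lia.
have hj1 : h N = (h x.+1 + j.-1%:Z)%R by rewrite hj hx1; lia.
rewrite (edge_count_cat hxx) doubleD (IH x.+1 l j.-1 ltac:(lia) ltac:(lia) H1 hj1).
rewrite /edge_count big_nat1 eE.
case: j j0 {IH hj eE hj1 hN} => //= k _; case: (ltngtP k m) => hk.
- by have -> : k.+1 - m = 0 by [lia]; rewrite orbT /=; lia.
- by rewrite subSn //=; [|lia]; case: (boolP (odd (k - m))) => /=; lia.
- by rewrite hk subSnn /=; lia.
Qed.

(** Each edge starting in the strip contributes 2 to the exponent; odd [l' - m] with [l' >= m] is
    excluded by [valid]. *)
Lemma edge_count_weight x y l l' : valid b m x y -> y = x + l.*2 + l' ->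
  h y = (h x + l'%:Z)%R -> weight_exp m (l, l') = (edge_count x y).*2.
Proof.
move=> /validP[hxy H hv] Ey Eh; rewrite /weight_exp; case: hv => [E|[yN hv]].
  rewrite edge_count_Z //; have -> : l' = 0 by lia.
  by rewrite m_gt0; lia.
subst y; rewrite yN (edge_count_suffix (l := l) (j := l')) //;
  [|by move=> v hw; apply: H; lia|by rewrite -yN].
move: hv; rewrite Eh.
have -> : `|(h x + l'%:Z - h x)%R|%N = l' by lia.
case: (ltngtP l' m) => [||->]; [lia| |by rewrite subnn /=; lia].
by move=> ml [|odd_l]; [lia|rewrite (negbTE odd_l) /=; lia].
Qed.

End EdgeCount.

(** * Boxes and strips *)

Section Boxes.
Variables a b : seq bool.
Hypothesis size_ab : size a = size b.
Notation N := (size b).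
Notation h := (height b).
Notation depth := (depth a b).
Notation R := (region a b).

Lemma height_ones w i : i <= size w -> (height w i = (ones (take i w)).*2%:Z - i%:Z)%R.
Proof.
move=> hi; have : ones (take i w) + twos (take i w) = i.
  rewrite /ones /twos -[RHS](size_takel hi) -(count_predC (pred1 true)).
  by congr addn; apply: eq_count => -[].
by rewrite /height; lia.
Qed.

Lemma ones_take_le w i : ones (take i w) <= i.
Proof.
by apply: leq_trans (count_size _ _) _; rewrite size_take_min geq_minl.
Qed.

(** Where [a] runs above [b], it does so by [(depth i).*2]; the parity condition keeps every second
    height, so [k] counts the boxes of a column from below. *)
Lemma mem_region i (j : int) : ((i, j) \in R) =
  (i <= N) && [exists k : 'I_N, (k < depth i) && (j == h i + 1 + k.*2%:Z)%R].
Proof.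
rewrite inE !in_lambda_plus /lambda_cond size_ab /=.
case: (leqP i N) => hi; last by rewrite andbF; case: (0 < i) => //=; rewrite !andbF.
rewrite !height_ones ?size_ab //=.
have oa := ones_take_le a i; have ob := ones_take_le b i.
apply/idP/existsP => [H|[k /andP[hk /eqP ->]]].
  have hk : `|(j - 1 - ((ones (take i b)).*2%:Z - i%:Z))%R|%N./2 < N by lia.
  exists (Ordinal hk); rewrite /depth /=; lia.
by move: hk; rewrite /depth; lia.
Qed.

Definition col (u : R) : nat := (val u).1.
(* The boxes of layer [k] lie along the path of [b] shifted up by [2k]. *)
Definition layer (u : R) : nat := `|((val u).2 - 1 - h (col u))%R|%N./2.

Lemma boxE (u : R) : [/\ 0 < col u <= N, layer u < depth (col u) &
  val u = (col u, (h (col u) + 1 + (layer u).*2%:Z)%R)].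
Proof.
have := valP u; rewrite /layer /col; case: (val u) => i j.
rewrite mem_region => /andP[hi /existsP[k /andP[hk /eqP ->]]] /=.
have -> : (`|(h i + 1 + k.*2%:Z - 1 - h i)%R|./2 = k)%N by lia.
split => //; rewrite hi andbT lt0n; apply/eqP => i0.
by move: hk; rewrite i0 /depth !take0.
Qed.

Lemma box_inj (u v : R) : col u = col v -> layer u = layer v -> u = v.
Proof.
move=> ec el; apply: val_inj; have [_ _ ->] := boxE u; have [_ _ ->] := boxE v.
by rewrite ec el.
Qed.

Lemma depth_le i : depth i <= i.
Proof. by rewrite /depth; have := ones_take_le a i; lia. Qed.

Lemma box_ex i k : i <= N -> k < depth i -> exists u : R, col u = i /\ layer u = k.
Proof.
move=> hi hk.
have kN : k < N by have := depth_le i; lia.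
have hu : (i, (h i + 1 + k.*2%:Z)%R) \in R.
  rewrite mem_region hi; apply/existsP; exists (Ordinal kN).
  by rewrite hk eqxx.
exists [` hu]%fset; rewrite /layer /col /=; split => //; lia.
Qed.

Lemma just_belowE (u v : R) :
  just_below (val u) (val v) = (col u == col v) && (layer v == (layer u).+1).
Proof.
have [_ _ ->] := boxE u; have [_ _ ->] := boxE v; rewrite /just_below /= xpair_eqE.
by case: eqP => //= ->; apply/eqP/eqP; lia.
Qed.

Definition run x y k : {set R} := [set u | (layer u == k) && (x <= col u <= y)].

Definition runnable x y k := [&& 0 < x, x <= y & y <= N] &&
  all (fun i => k < depth i) (iota x (y - x).+1).

Lemma runnableP x y k : reflect (0 < x <= y /\ y <= N /\ forall i, x <= i <= y -> k < depth i)
  (runnable x y k).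
Proof.
apply: (iffP andP) => [[/and3P[h1 h2 h3] /allP H]|[/andP[h1 h2] [h3 H]]].
  by rewrite h1 h2; split => //; split => // i hi; apply: H; rewrite mem_iota; lia.
by rewrite h1 h2 h3; split => //; apply/allP => i; rewrite mem_iota => hi; apply: H; lia.
Qed.

Lemma box_fun (s : seq (nat * nat)) : (0 < size s) ->
  (forall q, q \in s -> q.1 <= N /\ q.2 < depth q.1) ->
  exists g : nat * nat -> R, forall q, q \in s -> col (g q) = q.1 /\ layer (g q) = q.2.
Proof.
case: s => // q0 s _ H; have [h1 h2] := H q0 (mem_head _ _).
have [u0 _] := box_ex h1 h2.
exists (fun q => odflt u0 [pick u | (col u == q.1) && (layer u == q.2)]) => q hq.
case: pickP => [u /andP[/eqP -> /eqP ->] //|].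
have [g1 g2] := H q hq; have [u [e1 e2]] := box_ex g1 g2.
by move/(_ u); rewrite e1 e2 !eqxx.
Qed.

Lemma sum_boxes (s : seq (nat * nat)) (F : nat -> nat -> nat) : uniq s ->
  (forall q, q \in s -> q.1 <= N /\ q.2 < depth q.1) ->
  \sum_(u : R | (col u, layer u) \in s) F (col u) (layer u) = \sum_(q <- s) F q.1 q.2.
Proof.
case: (ltnP 0 (size s)) => hs us H; last first.
  have -> : s = [::] by apply/nilP; rewrite /nilp -leqn0.
  by rewrite big_nil big_pred0.
have [g Hg] := box_fun hs H.
have ug : uniq (map g s).
  rewrite map_inj_in_uniq // => q q' hq hq' E.
  have [e1 e2] := Hg q hq; have [e1' e2'] := Hg q' hq'.
  by rewrite [q]surjective_pairing [q']surjective_pairing -e1 -e2 -e1' -e2' E.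
transitivity (\sum_(u <- map g s) F (col u) (layer u)).
  rewrite big_uniq //; apply: eq_bigl => u; apply/idP/mapP => [hu|[q hq ->]].
    have [e1 e2] := Hg _ hu; exists (col u, layer u) => //.
    by apply/esym/box_inj.
  by have [-> ->] := Hg q hq; rewrite -surjective_pairing.
by rewrite big_map; apply: eq_big_seq => q /Hg[-> ->].
Qed.

Lemma sum_run x y k (F : nat -> nat) : runnable x y k ->
  \sum_(u in run x y k) F (col u) = \sum_(x <= i < y.+1) F i.
Proof.
move=> /runnableP[h1 [h2 h3]].
pose s := [seq (i, k) | i <- index_iota x y.+1].
transitivity (\sum_(u : R | (col u, layer u) \in s) F (col u)).
  apply: eq_bigl => u; rewrite inE; apply/andP/mapP => [[/eqP <- hu]|[i]].
    by exists (col u); rewrite ?mem_index_iota.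
  by rewrite mem_index_iota => hi [-> ->].
rewrite (@sum_boxes s (fun i _ => F i)) ?big_map //.
  by rewrite map_inj_uniq ?iota_uniq // => i j [].
by move=> q /mapP[i]; rewrite mem_index_iota => hi -> /=; split; [lia|apply: h3; lia].
Qed.

Lemma sum_column i (F : nat -> nat) : i <= N ->
  \sum_(u : R | col u == i) F (layer u) = \sum_(0 <= k < depth i) F k.
Proof.
move=> hi.
pose s := [seq (i, k) | k <- index_iota 0 (depth i)].
transitivity (\sum_(u : R | (col u, layer u) \in s) F (layer u)).
  apply: eq_bigl => u; apply/eqP/mapP => [E|[k _ [-> _]] //].
  by exists (layer u); rewrite ?E // mem_index_iota -E; have [_ ->] := boxE u.
rewrite (@sum_boxes s (fun _ k => F k)) ?big_map //.
  by rewrite map_inj_uniq ?iota_uniq // => j j' [].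
by move=> q /mapP[k]; rewrite mem_index_iota => hk ->.
Qed.

Lemma card_run x y k : runnable x y k -> #|run x y k| = y.+1 - x.
Proof.
move=> hr; rewrite -sum1_card (sum_run (fun=> 1) hr) sum_nat_const_nat muln1 //.
Qed.

Lemma run_inj x y k x' y' k' : runnable x y k -> runnable x' y' k' ->
  run x y k = run x' y' k' -> [/\ x = x', y = y' & k = k'].
Proof.
have key x1 y1 k1 x2 y2 k2 : runnable x1 y1 k1 -> run x1 y1 k1 = run x2 y2 k2 ->
    [/\ x2 <= x1, y1 <= y2 & k1 = k2].
  move=> /runnableP[h1 [h2 h3]] E.
  have [u [u1 u2]] := box_ex (ltac:(lia) : x1 <= N) (h3 x1 ltac:(lia)).
  have [v [v1 v2]] := box_ex h2 (h3 y1 ltac:(lia)).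
  have : u \in run x1 y1 k1 by rewrite inE u1 u2 eqxx; lia.
  have : v \in run x1 y1 k1 by rewrite inE v1 v2 eqxx; lia.
  rewrite E !inE u1 u2 v1 v2 => /andP[/eqP kk hv] /andP[_ hu]; split => //; lia.
move=> r r' E; have [h1 h2 ->] := key _ _ _ _ _ _ r E.
by have [h3 h4 _] := key _ _ _ _ _ _ r' (esym E); split => //; lia.
Qed.

Lemma path_run (g : nat -> R) k x n :
  (forall i, x <= i <= x + n -> col (g i) = i /\ layer (g i) = k) ->
  path step (val (g x)) (map val (map g (iota x.+1 n))) /\
  last (val (g x)) (map val (map g (iota x.+1 n))) = val (g (x + n)).
Proof.
elim: n x => [|n IH] x H /=; first by rewrite addn0.
have [|-> ->] := IH x.+1; first by move=> i hi; apply: H; lia.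
rewrite addSnnS; split => //; rewrite andbT /step.
have [e1 e2] := H x ltac:(lia); have [e1' e2'] := H x.+1 ltac:(lia).
have [_ _ ->] := boxE (g x); have [c1 _ ->] := boxE (g x.+1) => /=.
rewrite e1 e2 e1' e2' eqxx /= heightS; last lia.
by case: nth; apply/orP; [left|right]; apply/eqP; lia.
Qed.

Lemma ballot_run x y k l l' : runnable x y k -> y = x + l.*2 + l' ->
  (forall v, x <= v <= y -> (h x <= h v)%R) -> h y = (h x + l'%:Z)%R ->
  ballot_strip l l' (run x y k).
Proof.
move=> /runnableP[h1 [h2 h3]] Ey H E.
have [|q /mapP[i]|g Hg] := @box_fun [seq (i, k) | i <- iota x (y - x).+1].
- by rewrite size_map size_iota.
- by rewrite mem_iota => hi -> /=; split; [lia|apply: h3; lia].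
have {}Hg i : x <= i <= y -> col (g (i, k)) = i /\ layer (g (i, k)) = k.
  by move=> hi; apply: (Hg (i, k)); apply: map_f; rewrite mem_iota; lia.
pose f i := g (i, k).
have [] := @path_run f k x (y - x).
  by move=> i hi; apply: Hg; lia.
have -> : x + (y - x) = y by lia.
move=> hp hl; apply/existsP; exists (f x).
have sz : size (map f (iota x.+1 (y - x))) == l.*2 + l' by rewrite size_map size_iota; lia.
apply/existsP; exists (Tuple sz); apply/andP; split.
  rewrite /ballot_path hp hl /=; have [e1 e2] := Hg x ltac:(lia); have [e1' e2'] := Hg y ltac:(lia).
  apply/andP; split.
    have [_ _ ->] := boxE (f x); have [_ _ ->] := boxE (f y); rewrite e1 e2 e1' e2' /=.
    by apply/eqP; congr pair; lia.
  rewrite -map_comp all_map; apply/allP => i; rewrite mem_iota => hi /=.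
  have [e1'' e2''] := Hg i ltac:(lia).
  have [_ _ ->] := boxE (f x); have [_ _ ->] := boxE (f i); rewrite e1 e2 e1'' e2'' /=.
  by have := H i ltac:(lia); lia.
apply/eqP/setP => u; rewrite !inE.
have -> : (u == f x) || (u \in map f (iota x.+1 (y - x))) = (u \in map f (iota x (y - x).+1)).
  by rewrite /= inE.
apply/andP/mapP => [[/eqP e hu]|[i]].
  exists (col u); first by rewrite mem_iota; lia.
  by have [e1 e2] := Hg _ hu; apply: box_inj; rewrite /f ?e1 ?e2.
by rewrite mem_iota => hi ->; have [-> ->] := Hg i ltac:(lia); rewrite eqxx; split => //; lia.
Qed.

(** A ballot path moves one column at a time, so within one layer it meets each column of an
    interval once, at heights that are those of [b] shifted by a constant. *)
Lemma ballot_strip_run l l' (D : {set R}) k : ballot_strip l l' D ->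
  (forall u, u \in D -> layer u = k) ->
  exists x y, [/\ runnable x y k, D = run x y k, y = x + l.*2 + l',
    forall v, x <= v <= y -> (h x <= h v)%R & h y = (h x + l'%:Z)%R].
Proof.
case/existsP => u /existsP[p /andP[/and3P[hp /eqP hl /allP ha] /eqP ->]] hk.
set n := l.*2 + l' in p hp hl ha hk *.
move: (tval p) (size_tuple p) hp hl ha hk => {}p szp hp hl ha hk.
have cols : [seq col v | v <- u :: p] = iota (col u) n.+1.
  rewrite -szp; move: hp; clear; elim: p u => //= v p IH u /andP[/andP[/eqP hs _] /IH].
  by rewrite /= => ->; rewrite /col hs.
have mem i : col u <= i <= col u + n -> exists v, [/\ v \in u :: p, col v = i & layer v = k].
  move=> hi; have : i \in [seq col v | v <- u :: p] by rewrite cols mem_iota; lia.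
  by case/mapP => v hv ->; exists v; split => //; apply: hk; rewrite inE.
have inS v : v \in u :: p -> col u <= col v <= col u + n.
  move=> hv; have := map_f col hv; rewrite cols mem_iota; lia.
have uk : layer u = k by apply: hk; rewrite inE mem_head.
have [cu du Eu] := boxE u.
have [w [hw cw kw]] := mem (col u + n) ltac:(lia).
have [cw' dw Ew] := boxE w.
exists (col u), (col u + n); split.
- apply/runnableP; split; [lia|split; first by rewrite cw in cw'; lia].
  by move=> i /mem[v [_ <- <-]]; have [] := boxE v.
- apply/setP => v; rewrite !inE -in_cons; apply/idP/andP => [hv|[/eqP vk hv]].
    by rewrite inS // hk ?eqxx // inE.
  by have [v' [hv' e1 e2]] := mem _ hv; rewrite (@box_inj v v') ?vk.
- by rewrite /n; lia.
- move=> i /mem[v [hv <- vk]]; move: hv; rewrite inE => /orP[/eqP -> //|hv].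
  have := ha (val v) (map_f _ hv); have [_ _ ->] := boxE v; rewrite Eu /= uk vk; lia.
have Ew' : val w = last (val u) (map val p).
  rewrite last_map; congr val; apply: box_inj; last by rewrite kw hk // inE mem_last.
  rewrite cw (last_nth u) szp.
  have : nth 0 [seq col v | v <- u :: p] n = nth 0 (iota (col u) n.+1) n by rewrite cols.
  by rewrite nth_iota // (nth_map u) //= szp.
move: hl; rewrite -Ew' Ew Eu cw uk kw => -[]; lia.
Qed.

End Boxes.

(** * Profiles and configurations *)

(** A bounded, downward closed set of naturals is an initial segment, so its cardinality decides
    membership; this turns sets of layers into numbers. *)
Lemma card_initial n (Q : pred nat) : (forall k, Q k.+1 -> Q k) -> (forall k, Q k -> k < n) ->
  forall k, Q k = (k < #|[set i : 'I_n | Q i]|).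
Proof.
move=> down bnd.
have ex : exists k, ~~ Q k by exists n; apply/negP => /bnd; rewrite ltnn.
case: (ex_minnP ex) => t nQt tmin.
have QE k : Q k = (k < t).
  apply/idP/idP => [Qk|kt]; last first.
    by apply/negPn/negP => /tmin; rewrite leqNgt kt.
  rewrite ltnNge; apply/negP => tk; case/negP: nQt.
  move: Qk; rewrite -(subnK tk); elim: (k - t) => // i IH.
  by rewrite addSn => /down.
have tn : t <= n by apply: tmin; apply/negP => /bnd; rewrite ltnn.
move=> k; rewrite QE; congr (_ < _).
rewrite -sum1_card -[LHS]card_ord -sum1_card (big_ord_widen n (fun=> 1) tn).
by apply: eq_bigl => i; rewrite inE QE.
Qed.

(** * The partition of the region defined by a profile *)

Section Layers.
Variables a b : seq bool.
Notation N := (size b).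
Notation h := (height b).
Notation depth := (depth a b).
Notation R := (region a b).
Notation run := (run a b).
Notation runnable := (runnable a b).

Section Profile.
Variable c : nat -> nat.


(** Letter [p] joins columns [p] and [p.+1], so the letters between two boxes start at the smaller
    column and exclude the larger one. *)
Definition link (u v : R) := (layer u == layer v) &&
  all (fun p => layer u < c p)
      (iota (minn (col u) (col v)) (maxn (col u) (col v) - minn (col u) (col v))).

Lemma linkP u v : reflect (layer u = layer v /\
    forall p, minn (col u) (col v) <= p < maxn (col u) (col v) -> layer u < c p)
  (link u v).
Proof.
apply: (iffP andP) => -[].
  by move=> /eqP -> /allP H; split => // p hp; apply: H; rewrite mem_iota; lia.
move=> -> H; rewrite eqxx; split => //; apply/allP => p; rewrite mem_iota => hp.
by apply: H; lia.
Qed.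

Lemma link_equiv : {in [set: R] & &, equivalence_rel link}.
Proof.
have sym u v : link u v -> link v u.
  by move=> /linkP[e H]; apply/linkP; split => // p hp; rewrite -e; apply: H; lia.
have trans u v w : link u v -> link v w -> link u w.
  move=> /linkP[e H] /linkP[e' H']; apply/linkP; split; first by rewrite e.
  move=> p hp; case: (boolP (minn (col u) (col v) <= p < maxn (col u) (col v))) => hp'.
    exact: H.
  by rewrite e; apply: H'; lia.
move=> u v w _ _ _; split; first by apply/linkP; split => // p; lia.
by move=> uv; apply/idP/idP; [apply: trans; apply: sym|apply: trans].
Qed.

Definition layers : {set {set R}} := equivalence_partition link [set: R].

Lemma layers_partition : partition layers [set: R].
Proof. exact: equivalence_partitionP link_equiv. Qed.

Hypothesis size_ab : size a = size b.

Definition maxrun x y k := [/\ runnable x y k, forall p, x <= p < y -> k < c p,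
  c x.-1 <= k & y < N -> c y <= k].

Hypothesis c_depth : forall p, (c p <= depth p) && (c p <= depth p.+1).

Lemma profile0 : c 0 = 0.
Proof. by have := c_depth 0; rewrite /depth !take0; lia. Qed.

Lemma link_maxrun x y k u : maxrun x y k -> u \in run x y k ->
  forall v, link u v = (v \in run x y k).
Proof.
case=> /(runnableP size_ab)[h1 [h2 hd]] h3 h4 h5; rewrite inE => /andP[/eqP uk hu] v.
have [cv _ _] := boxE size_ab v.
rewrite inE; apply/linkP/andP => [[e H]|[/eqP vk hv]].
  split; first by rewrite -e uk.
  apply/andP; split; rewrite leqNgt; apply/negP => hlt.
    by have := H x.-1 ltac:(lia); rewrite uk ltnNge h4.
  by have := H y ltac:(lia); rewrite uk ltnNge h5 //; lia.
by split => [|p hp]; rewrite uk //; apply: h3; lia.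
Qed.

Lemma maxrun_layers x y k : maxrun x y k -> run x y k \in layers.
Proof.
move=> mr; have [/(runnableP size_ab)[h1 [h2 hd]] h3 h4 h5] := mr.
have [u [ux uk]] := box_ex size_ab (ltac:(lia) : x <= N) (hd x ltac:(lia)).
have hu : u \in run x y k by rewrite inE ux uk eqxx; lia.
apply/imsetP; exists u => //; apply/setP => v.
by rewrite [RHS]inE in_setT -(link_maxrun mr hu).
Qed.

Lemma maxrun_ex (u : R) : exists x y, maxrun x y (layer u) /\ u \in run x y (layer u).
Proof.
set k := layer u; set i := col u; have [ci du _] := boxE size_ab u.
pose P x := (x <= i) && all (fun p => k < c p) (iota x (i - x)).
have Pi : P i by rewrite /P subnn leqnn.
case: (ex_minnP (ex_intro _ i Pi)) => x /andP[xi /allP xr] xmin.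
have {}xr p : x <= p < i -> k < c p by move=> hp; apply: xr; rewrite mem_iota; lia.
pose Q y := (i <= y <= N) && all (fun p => k < c p) (iota i (y - i)).
have Qi : Q i by rewrite /Q subnn leqnn /= andbT; case/andP: ci.
have Qb y : Q y -> y <= N by case/andP => /andP[].
case: (ex_maxnP (ex_intro _ i Qi) Qb) => y /andP[iy /allP yr] ymax.
have {}yr p : i <= p < y -> k < c p by move=> hp; apply: yr; rewrite mem_iota; lia.
have xyr p : x <= p < y -> k < c p.
  by move=> hp; case: (leqP i p) => hip; [apply: yr|apply: xr]; lia.
(* Column 0 has no boxes: the depth is 0 there, so letter 0 is covered in no layer and stops the
   run. *)
have x0 : 0 < x.
  rewrite lt0n; apply/eqP => E; have := xr 0; rewrite profile0 E /=.
  by case/andP: ci => -> _ /(_ isT).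
have hd v : x <= v <= y -> k < depth v.
  move=> hv; case: (ltngtP v i) => [vi|vi|->]; [| |exact: du].
    by have := xyr v ltac:(lia); have /andP[] := c_depth v; lia.
  have := xyr v.-1 ltac:(lia); have /andP[_] := c_depth v.-1.
  have -> : v.-1.+1 = v by lia.
  by lia.
have hr : runnable x y k by apply/(runnableP size_ab); split; [lia|split; [lia|]].
exists x, y; split; last by rewrite inE eqxx /= -/i; lia.
split => //.
  rewrite leqNgt; apply/negP => hc; have := xmin x.-1; rewrite /P.
  have -> : i - x.-1 = (i - x).+1 by lia.
  rewrite /= hc prednK //= => /(_ _) H; have : x <= x.-1; last by lia.
  apply: H; apply/andP; split; first lia.
  by apply/allP => p; rewrite mem_iota => hp; apply: xr; lia.
move=> yN; rewrite leqNgt; apply/negP => hc; have := ymax y.+1; rewrite /Q.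
have -> : (i <= y.+1 <= N) by lia.
suff -> : all (fun p => k < c p) (iota i (y.+1 - i)) by move=> /(_ isT); lia.
apply/allP => p; rewrite mem_iota => hp; case: (ltngtP p y) => [py|py|-> //]; [apply: yr; lia|lia].
Qed.

Lemma layersP D : D \in layers -> exists x y k, maxrun x y k /\ D = run x y k.
Proof.
case/imsetP => u _ ->; have [x [y [mr hu]]] := maxrun_ex u.
exists x, y, (layer u); split => //; apply/setP => v.
by rewrite [LHS]inE in_setT (link_maxrun mr hu).
Qed.

Lemma pblock_layers u v : (v \in pblock layers u) = link u v.
Proof. by rewrite pblock_equivalence_partition ?in_setT //; exact: link_equiv. Qed.

(** These are the layers whose strip ending in the last column starts exactly at [x]; for
    [full_layers] it starts at or before [x]. Indices below [N] suffice because
    [c p <= depth p <= p]. *)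
Definition exact_layers x := [set k : 'I_N | all (fun p => k < c p) (iota x (N - x))
                                              && (c x.-1 <= k)].
Definition full_layers x := [set k : 'I_N | all (fun p => k < c p) (iota x (N - x))].

Lemma coversP x k : reflect (covers b c k x) (all (fun p => k < c p) (iota x (N - x))).
Proof.
apply: (iffP allP) => H p hp; apply: H; first by rewrite mem_iota; lia.
by move: hp; rewrite mem_iota; lia.
Qed.

Lemma covers_lt x k : x < N -> covers b c k x -> k < N.
Proof.
move=> xN H; have := H x ltac:(lia); have /andP[h1 _] := c_depth x.
by have := depth_le size_ab x; lia.
Qed.

Lemma coversE x k : x < N ->
  all (fun p => k < c p) (iota x (N - x)) = (k < #|full_layers x|).
Proof.
move=> xN.
apply: (@card_initial N (fun k => all (fun p => k < c p) (iota x (N - x)))) => {}k.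
  by apply: sub_all => p; apply: ltnW.
by move=> /coversP; apply: covers_lt.
Qed.

Lemma exact_full x : 0 < x < N -> #|full_layers x| = #|exact_layers x| + #|full_layers x.-1|.
Proof.
move=> hx.
rewrite -(cardsID [set k : 'I_N | c x.-1 <= k] (full_layers x)).
congr (_ + _); apply: eq_card => k; rewrite !inE // -ltnNge.
have -> : N - x.-1 = (N - x).+1 by lia.
by rewrite /= prednK //; lia.
Qed.

Variable m : nat.
Notation edge := (edge b m).
Notation endp := (endp b m).
Notation long := (long b m).

Hypothesis c_span : spanned m b c.

Lemma maxrun_valid x y k : maxrun x y k -> valid b m x y.
Proof.
case=> /(runnableP size_ab)[h1 [h2 _]] h3 h4 h5.
by apply: (run_valid c_span _ h3 _ h5); [lia|].
Qed.

Hypothesis m_gt0 : 0 < m.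

(** Starting from the empty [full_layers 0], each step to the right adds [exact_layers x]. If that
    set is not empty, [x] starts a valid word up to the end, which is long because it contains the
    long one from [y]. *)
Lemma even_full : (forall x, 0 < x -> long x -> ~~ odd #|exact_layers x|) ->
  forall x y k, x <= y -> long y -> ~~ odd k -> covers b c k x -> covers b c k.+1 x.
Proof.
move=> ev.
suff H x y : x <= y -> long y -> ~~ odd #|full_layers x|.
  move=> x y k xy ly ek; have [yN _ _] := longP _ m_gt0 _ ly.
  have xN : x < N by lia.
  have := H _ _ xy ly; move=> /[swap] /coversP; rewrite (coversE _ xN) => hk hodd.
  apply/coversP; rewrite (coversE _ xN).
  by case: (ltngtP k.+1 #|full_layers x|) hk hodd => // <-; rewrite /= ek.
move=> + ly; have [yN _ _] := longP _ m_gt0 _ ly.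
elim: x => [|x IH] xy.
  rewrite (_ : full_layers 0 = set0) ?cards0 //; apply/setP => k; rewrite !inE.
  by apply/negbTE/negP => /allP/(_ 0); rewrite mem_iota profile0; lia.
rewrite exact_full; last lia.
rewrite oddD negb_add /= (negbTE (IH (ltnW xy))); apply/eqP/negbTE.
case: (set_0Vmem (exact_layers x.+1)) => [->|[k]]; first by rewrite cards0.
rewrite inE => /andP[/coversP hk hx]; apply: ev => //; apply: long_left ly => //.
by apply: (run_valid c_span _ hk) => //; lia.
Qed.

(** An odd number of full layers would have a top layer of even index, contradicting the hypothesis.
    So these numbers are even, and [exact_layers] counts the difference of two of them. *)
Lemma full_even x : (forall x y k, x <= y -> long y -> ~~ odd k ->
    covers b c k x -> covers b c k.+1 x) ->
  0 < x -> long x -> ~~ odd #|exact_layers x|.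
Proof.
move=> H x0 lx; have [xN _ _] := longP _ m_gt0 _ lx.
have ev y : y <= x -> ~~ odd #|full_layers y|.
  move=> yx; have yN : y < N by lia.
  case E : #|full_layers y| => [//|k] /=; rewrite negbK; apply/negPn/negP => ek.
  have := H _ _ _ yx lx ek; have /coversP hk : all (fun p => k < c p) (iota y (N - y)).
    by rewrite coversE // E.
  by move=> /(_ hk)/coversP; rewrite coversE // E ltnn.
have := ev x (leqnn x); rewrite exact_full; last lia.
by rewrite oddD (negbTE (ev _ (leq_pred x))) addbF.
Qed.

(* The strips ending at the last column whose word has [l'] unpaired 1's all  *)
(* start at the same column, one for each layer of [exact_layers].            *)
Lemma card_strips x l l' : 0 < x -> long x -> x + l.*2 + l' = N ->
  h N = (h x + l'%:Z)%R ->
  #|[set D in layers | ballot_strip l l' D]| = #|exact_layers x|.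
Proof.
move=> x0 lx El Eh; have [xN hx _] := longP _ m_gt0 _ lx.
have l'0 : 0 < l' by move: lx => /andP[_]; rewrite Eh; lia.
have mr (k : 'I_N) : k \in exact_layers x -> maxrun x N k.
  rewrite inE => /andP[/coversP hk hc]; split => //; last by lia.
  apply/(runnableP size_ab); split; [lia|split => // i hi].
  case: (ltngtP i N) => iN; [|lia|].
    by have := hk i ltac:(lia); have /andP[] := c_depth i; lia.
  have := hk N.-1 ltac:(lia); have /andP[_] := c_depth N.-1.
  have -> : N.-1.+1 = i by lia.
  by lia.
have inj : {in exact_layers x &, injective (fun k : 'I_N => run x N k : {set R})}.
  move=> k k' /mr[rk _ _ _] /mr[rk' _ _ _] /= E; apply: val_inj.
  by have [_ _] := run_inj size_ab rk rk' E.
rewrite -(card_in_imset inj); apply: eq_card => D.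
rewrite inE; apply/andP/imsetP => [[hD hb]|[k hk ->]]; last first.
  have mrk := mr k hk; split; first exact: maxrun_layers.
  by apply: ballot_run => //; case: mrk.
have [x' [y' [k [mrk ED]]]] := layersP hD.
have [r1 r2 r3 r4] := mrk; have /(runnableP size_ab)[h1 [h2 hd]] := r1.
have hlay u : u \in D -> layer u = k by rewrite ED inE => /andP[/eqP].
have [x'' [y'' [r1' ED' Ey Hx Hy]]] := ballot_strip_run size_ab hb hlay.
have := run_inj size_ab r1 r1'; rewrite -ED -ED' => /(_ erefl)[Ex' Ey' _].
rewrite -Ex' -Ey' in Ey Hx Hy; have /validP[_ _ [E|[yN _]]] := maxrun_valid mrk.
  by move: Hy; rewrite E; lia.
have Exx : x' = x by lia.
rewrite Exx yN in r2 r3 ED *.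
have kN : k < N by apply: (covers_lt xN) r2.
by exists (Ordinal kN); rewrite // inE r3 andbT; apply/coversP.
Qed.

End Profile.
End Layers.

(** * The layers of a profile form a configuration, and its weight *)

Section Configurations.
Variables (m : nat) (a b : seq bool).
Hypothesis size_ab : size a = size b.
Notation N := (size b).
Notation h := (height b).
Notation depth := (depth a b).
Notation R := (region a b).
Notation run := (run a b).
Notation runnable := (runnable a b).
Notation edge := (edge b m).
Notation endp := (endp b m).
Notation long := (long b m).
Notation layers := (layers a b).
Notation profile := (profile m a b).
Notation boxE := (boxE size_ab).

Lemma runnable_bound x y k : runnable x y k -> y - x < #|` R|.
Proof.
move=> hr; have /(runnableP size_ab)[h1 _] := hr.
rewrite cardfE; apply: leq_trans (max_card (mem (run x y k))).
by have := card_run size_ab hr; rewrite /= => ->; lia.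
Qed.

Lemma run_layer x y k (u : R) : u \in run x y k -> layer u = k.
Proof. by rewrite inE => /andP[/eqP]. Qed.

Lemma ballot_strip_runE x y k l l' : runnable x y k -> ballot_strip l l' (run x y k) ->
  y = x + l.*2 + l' /\ h y = (h x + l'%:Z)%R.
Proof.
move=> hr /(ballot_strip_run size_ab) /(_ (@run_layer x y k)) [x' [y' [hr' E Ey _ Eh]]].
by have [-> -> _] := run_inj size_ab hr hr' E.
Qed.

Lemma run_strip x y k : runnable x y k -> valid b m x y ->
  exists l l', [/\ ballot_strip l l' (run x y k), maxn l l' < #|` R|,
    strip_length (run x y k) = (l, l'), y = x + l.*2 + l' & h y = (h x + l'%:Z)%R].
Proof.
move=> hr hv; have [l [l' [Ey Eh]]] := valid_shape hv.
have hb := runnable_bound hr.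
have bl : l < #|` R| by lia.
have bl' : l' < #|` R| by lia.
have hs : ballot_strip l l' (run x y k).
  by apply: ballot_run => //; case/validP: hv.
exists l, l'; split => //; first by rewrite gtn_max bl.
rewrite /strip_length; case: pickP => [[[s hsl] [s' hsl']] /= hs'|]; last first.
  by move/(_ (Ordinal bl, Ordinal bl')); rewrite /= hs.
by have [Ey' Eh'] := ballot_strip_runE hr hs'; congr pair; lia.
Qed.

Hypothesis m_gt0 : 0 < m.

Lemma strip_weight x y k : runnable x y k -> valid b m x y ->
  weight_exp m (strip_length (run x y k)) = (edge_count b m x y).*2.
Proof.
move=> hr hv; have [l [l' [_ _ -> Ey Eh]]] := run_strip hr hv.
exact: edge_count_weight hv Ey Eh.
Qed.

Section FromProfile.
Variable c : nat -> nat.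
Hypothesis pc : profile c.

Let c_span := profile_span pc.
Let c_depth := profile_depth pc.

Lemma layers_rule0 : rule0 (size a) (layers c).
Proof.
apply/forall_inP => D /(layersP size_ab c_depth)[x [y [k [mr ->]]]].
have [hr _ _ _] := mr; have hv := maxrun_valid size_ab c_span mr.
have [l [l' [_ _ -> Ey Eh]]] := run_strip hr hv; apply/implyP => /= l'0.
apply/forall_inP => u; rewrite inE => /andP[_ hu]; apply/implyP => /forall_inP H.
have /(runnableP size_ab)[h1 [h2 hd]] := hr.
have [v [cv lv]] := box_ex size_ab h2 (hd y ltac:(lia)).
have hvD : v \in run x y k by rewrite inE cv lv eqxx; lia.
have := H v hvD; rewrite -/(col v) -/(col u) cv => yu.
have /validP[_ _ [E|[E _]]] := hv; first by move: Eh; rewrite E; lia.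
by rewrite size_ab; apply/eqP; lia.
Qed.

(** A letter covered in layer k + 1 is covered in layer k, so linked boxes stay linked when both
    move down by one layer. *)
Lemma layers_ruleIa : ruleIa (layers c).
Proof.
have part := layers_partition a b c.
have [/eqP cov triv _] := and3P part.
apply/forall_inP => D hD; apply/forall_inP => D' hD'; apply/implyP.
case/exists_inP => u hu /exists_inP[v hv]; rewrite just_belowE // => /andP[/eqP Ec /eqP El].
apply/forall_inP => v' hv'.
have : link c v v'.
  by rewrite -(pblock_layers) (def_pblock triv hD' hv).
case/linkP => Ek H; have [cv' dv' _] := boxE v'.
have [u' [cu' lu']] := box_ex size_ab (ltac:(lia) : col v' <= N)
                                      (ltac:(lia) : layer u < depth (col v')).
apply/exists_inP; exists u'; last by rewrite just_belowE // cu' lu' eqxx; lia.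
rewrite -(def_pblock triv hD hu) (pblock_layers); apply/linkP; split => // p hp.
by have := H p; rewrite -Ec -cu' El => /(_ hp); lia.
Qed.

(** Strips with [l' >= m] end in the last column, where [valid] excludes odd [l' - m]. For even
    [l' - m] they are counted by [exact_layers] at their common starting column. *)
Lemma layers_ruleIb : ruleIb m (layers c).
Proof.
apply/forallP => -[[l hl] [l' hl']] /=; apply/implyP => ml'.
set S := [set _ in _ | _].
have HS : (S == set0) || (~~ odd (l' - m) && ~~ odd #|S|).
  case: (set_0Vmem S) => [->|[D]]; rewrite ?eqxx // inE => /andP[hD hs].
  have [x [y [k [mr ED]]]] := layersP size_ab c_depth hD.
  have [hr _ _ _] := mr; have hv := maxrun_valid size_ab c_span mr.
  have /(runnableP size_ab)[h1 _] := hr.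
  have [Ey Eh] := ballot_strip_runE hr (etrans (congr1 _ (esym ED)) hs).
  have yN : y = N.
    by have /validP[_ _ [E|[//]]] := hv; move: Eh; rewrite E; lia.
  rewrite yN in hv Ey Eh.
  have lx : long x by rewrite /long hv Eh; lia.
  have /andP[_ ->] := long_strip m_gt0 lx (esym Ey) Eh.
  rewrite /S (card_strips size_ab c_depth c_span m_gt0 _ lx (esym Ey) Eh); last lia.
  rewrite (full_even size_ab c_depth m_gt0 (profile_even pc)) ?orbT //; lia.
case: ifP => ho; last by case/orP: HS => [/eqP ->|/andP[]//]; rewrite cards0.
by rewrite ho orbF in HS; rewrite (eqP HS) cards0.
Qed.

Lemma layers_conf : conf_I m (size a) (layers c).
Proof.
apply/and5P; split; [exact: layers_partition a b c| | |exact: layers_ruleIa|].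
- apply/forall_inP => D /(layersP size_ab c_depth)[x [y [k [mr ->]]]].
  have [hr _ _ _] := mr; have hv := maxrun_valid size_ab c_span mr.
  have [l [l' [hs hb _ _ _]]] := run_strip hr hv.
  move: hb; rewrite gtn_max => /andP[bl bl'].
  by apply/existsP; exists (Ordinal bl, Ordinal bl').
- exact: layers_rule0.
- exact: layers_ruleIb.
Qed.

(** Double counting of the boxes whose column [i] starts an edge and whose letter [i] is covered in
    their layer. A strip contains as many of them as edges start in it, its last box not being
    counted; the column of an edge [e] contains [c (val e)] of them. *)
Lemma layers_weight : \sum_(D in layers c) weight_exp m (strip_length D)
  = 2 * \sum_(e : edge_type m b) c (val e).
Proof.
have part := layers_partition a b c.
pose F (u : R) := edge (col u) && (layer u < c (col u)) : nat.
have FD D : D \in layers c -> weight_exp m (strip_length D) = (\sum_(u in D) F u).*2.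
  move=> /(layersP size_ab c_depth)[x [y [k [mr ->]]]].
  have [hr h2 h3 h4] := mr; have hv := maxrun_valid size_ab c_span mr.
  rewrite (strip_weight hr hv); congr (_.*2).
  have /(runnableP size_ab)[h1 _] := hr.
  transitivity (\sum_(u in run x y k) (edge (col u) && (col u < y)) : nat).
    rewrite (@sum_run _ _ size_ab _ _ _ (fun i => edge i && (i < y))) //.
    rewrite big_nat_recr /=; last lia.
    rewrite ltnn andbF addn0; apply: eq_big_nat => i /andP[_ ->].
    by rewrite andbT.
  apply: eq_bigr => u; rewrite inE /F => /andP[/eqP -> hu]; congr nat_of_bool.
  case: (boolP (edge (col u))) => // eu; apply/idP/idP => hc.
    by apply: h2; lia.
  rewrite ltnNge; apply/negP => hyu; have E : col u = y by lia.
  by rewrite E ltnNge h4 // -E ?(edge_lt eu) in hc.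
rewrite (eq_bigr _ FD).
under eq_bigr do rewrite -mul2n.
rewrite -big_distrr /=; congr (2 * _).
rewrite -(set_partition_big _ part) /=.
transitivity (\sum_(u : R) \sum_(e : edge_type m b)
                 ((col u == val e) && (layer u < c (val e)) : nat)).
  apply: eq_big => [u|u _]; first by rewrite in_setT.
  rewrite /F; case: (boolP (edge (col u))) => eu.
    have [e Ee] := edge_typeK m_gt0 eu.
    rewrite (bigD1 e) //= Ee eqxx big1 ?addn0 // => e' ne.
    by rewrite -Ee; case: eqP => // /val_inj E; rewrite E eqxx in ne.
  rewrite big1 // => e _; case: eqP => // E.
  by rewrite E (edge_typeP m_gt0) in eu.
rewrite exchange_big /=; apply: eq_bigr => e _.
have eN := edge_lt (edge_typeP m_gt0 e).
transitivity (\sum_(u : R | col u == val e) (layer u < c (val e))).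
  by rewrite [RHS]big_mkcond; apply: eq_bigr => u _; case: eqP.
rewrite (@sum_column _ _ size_ab _ (fun k => k < c (val e))) ?(ltnW eN) //.
have /andP[cd _] := c_depth (val e).
rewrite (@big_cat_nat _ _ _ (c (val e))) //= [X in _ + X]big1_seq ?addn0.
  rewrite (eq_big_nat _ _ (F2 := fun=> 1)); last by move=> k /andP[_ ->].
  by rewrite sum_nat_const_nat subn0 muln1.
by move=> k; rewrite mem_index_iota => /andP[_ /andP[hk _]]; rewrite ltnNge hk.
Qed.

End FromProfile.
End Configurations.

Lemma eq_layers a b c c' : c =1 c' -> layers a b c = layers a b c'.
Proof.
move=> E; apply: eq_imset => u; apply/setP => v; rewrite !inE /link.
by rewrite (eq_all (_ : _ =1 (fun p => layer u < c' p))) // => p; rewrite E.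
Qed.

(** * From configurations to profiles *)

Section FromConf.
Variables (m : nat) (a b : seq bool).
Hypothesis m_gt0 : 0 < m.
Hypothesis size_ab : size a = size b.
Notation N := (size b).
Notation h := (height b).
Notation depth := (depth a b).
Notation R := (region a b).
Notation run := (run a b).
Notation runnable := (runnable a b).
Notation edge := (edge b m).
Notation endp := (endp b m).
Notation long := (long b m).
Notation layers := (layers a b).
Notation profile := (profile m a b).
Notation boxE := (boxE size_ab).

Definition same_strip (P : {set {set R}}) k i := [exists u : R, exists v : R,
  [&& layer u == k, layer v == k, col u == i, col v == i.+1 & v \in pblock P u]].

Definition conf_profile (P : {set {set R}}) i := #|[set k : 'I_N | same_strip P k i]|.

Section Conf.
Variable P : {set {set R}}.
Hypothesis conf : conf_I m (size a) P.

Let part : partition P [set: R]. Proof. by case/and5P: conf. Qed.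
Let triv : trivIset P. Proof. by case/and3P: part. Qed.

Lemma conf_cover (u : R) : u \in cover P.
Proof. by case/and3P: part => /eqP -> _ _; rewrite in_setT. Qed.

Lemma conf_pblock (u : R) : pblock P u \in P /\ u \in pblock P u.
Proof. by rewrite pblock_mem ?mem_pblock conf_cover. Qed.

Lemma box_below (u : R) k : layer u = k.+1 -> exists v : R, [/\ col v = col u, layer v = k &
  just_below (val v) (val u)].
Proof.
move=> uk; have [cu du _] := boxE u.
have [v [cv lv]] := box_ex size_ab (ltac:(lia) : col u <= N) (ltac:(lia) : k < depth (col u)).
by exists v; split => //; rewrite just_belowE // cv lv uk !eqxx.
Qed.

Lemma conf_ruleIa (u v w : R) D : D \in P -> v \in D -> w \in D ->
  just_below (val u) (val v) -> exists2 x : R, x \in pblock P u & just_below (val x) (val w).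
Proof.
move=> hD hv hw huv; case/and5P: conf => _ _ _ /forall_inP rIa _.
have [hu1 hu2] := conf_pblock u.
have := rIa _ hu1 => /forall_inP/(_ _ hD)/implyP.
suff -> : [exists x in pblock P u, exists y in D, just_below (val x) (val y)].
  by move=> /(_ isT)/forall_inP/(_ _ hw)/exists_inP[x hx hxw]; exists x.
by apply/exists_inP; exists u => //; apply/exists_inP; exists v.
Qed.

(* By rule Ia, a box with nothing below it in its strip forces the whole strip *)
(* down to layer 0; in general strips do not change layer.                     *)
Lemma conf_layer D (u v : R) : D \in P -> u \in D -> v \in D -> layer u = layer v.
Proof.
move E : (layer u) => k; elim: k D u v E => [|k IH] D u v E hD hu hv.
  case F : (layer v) => [//|k]; have [w [_ _ hw]] := box_below F.
  have [x _] := conf_ruleIa hD hv hu hw.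
  by rewrite just_belowE // E andbF.
have [w [_ lw hw]] := box_below E.
have [x hx] := conf_ruleIa hD hu hv hw.
rewrite just_belowE // => /andP[_ /eqP ->].
by have [h1 h2] := conf_pblock w; rewrite (IH _ w x lw h1 h2 hx).
Qed.

(** A strip stays in one layer, hence is a run. If [l' >= 1], rule 0 makes it end in the last
    column, and rule Ib leaves no strip with [l' >= m] and [l' - m] odd. *)
Lemma conf_run D : D \in P -> exists x y k, [/\ runnable x y k, D = run x y k & valid b m x y].
Proof.
move=> hD; case/and5P: conf => _ /forall_inP/(_ D hD)/existsP[[[l hl] [l' hl']] /= hs] r0 _ rb.
have [u hu] : exists u, u \in D.
  by case: (set_0Vmem D) => [D0|[u]]; [case/and3P: part => _ _; rewrite -D0 hD|exists u].
have lay v : v \in D -> layer v = layer u by move=> hv; apply: conf_layer hD hv hu.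
have [x [y [hr ED Ey Hx Eh]]] := ballot_strip_run size_ab hs lay.
exists x, y, (layer u); split => //.
have /(runnableP size_ab)[h1 [h2 hd]] := hr.
have sl : strip_length D = (l, l').
  rewrite /strip_length; case: pickP => [[[s hsl] [s' hsl']] /= hs'|]; last first.
    by move/(_ (Ordinal hl, Ordinal hl')); rewrite /= hs.
  rewrite ED in hs'; have [Ey' Eh'] := ballot_strip_runE size_ab hr hs'.
  by move: Ey Eh Ey' Eh' h1; clear; move=> *; congr pair; lia.
apply/validP; split => //; first lia.
case: (posnP l') => l'0; first by left; rewrite Eh l'0 addr0.
right; split.
  have [v [cv lv]] := box_ex size_ab h2 (hd y ltac:(lia)).
  have hv : v \in D by rewrite ED inE cv lv eqxx; lia.
  move/forall_inP: r0 => /(_ D hD); rewrite sl l'0 /= => /forall_inP/(_ v hv)/implyP H.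
  have /eqP E : (val v).1 == size a.
    apply: H; apply/forall_inP => w; rewrite ED inE => /andP[_ /andP[_]].
    by rewrite -cv.
  by rewrite -size_ab -E -cv.
rewrite /=; have -> : `|(h y - h x)%R|%N = l' by lia.
case: (ltnP l' m) => [|ml]; [by left|right].
move/forallP: rb => /(_ (Ordinal hl, Ordinal hl'))/implyP/(_ ml) /=.
case: ifP => // ho; rewrite cards_eq0 => /eqP/setP/(_ D).
by rewrite !inE hD hs.
Qed.

Lemma same_stripP k i : same_strip P k i ->
  exists u v : R, [/\ layer u = k, layer v = k, col u = i, col v = i.+1 & v \in pblock P u].
Proof.
by case/existsP => u /existsP[v /and5P[/eqP ? /eqP ? /eqP ? /eqP ? ?]]; exists u, v.
Qed.

Lemma same_strip_run x y k i : run x y k \in P -> runnable x y k -> x <= i < y ->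
  same_strip P k i.
Proof.
move=> hD /(runnableP size_ab)[h1 [h2 hd]] hi.
have [u [cu lu]] := box_ex size_ab (ltac:(lia) : i <= N) (hd i ltac:(lia)).
have [v [cv lv]] := box_ex size_ab (ltac:(lia) : i.+1 <= N) (hd i.+1 ltac:(lia)).
apply/existsP; exists u; apply/existsP; exists v.
rewrite lu lv cu cv !eqxx /= (def_pblock triv hD) inE ?lu ?lv ?cu ?cv eqxx /=; lia.
Qed.

(** By rule Ia, the boxes below two neighbouring boxes of a strip share a strip too. So the layers
    in which letter [i] lies in a strip form an initial segment. *)
Lemma conf_profileE k i : (k < conf_profile P i) = same_strip P k i.
Proof.
rewrite /conf_profile -(@card_initial _ (fun k => same_strip P k i)) // => {}k.
  case/same_stripP => u [v [lu lv cu cv huv]].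
  have [w [cw lw hw]] := box_below lu; have [hu1 hu2] := conf_pblock u.
  have [x hx] := conf_ruleIa hu1 hu2 huv hw.
  rewrite just_belowE // => /andP[/eqP cx /eqP lx].
  apply/existsP; exists w; apply/existsP; exists x.
  by rewrite lw cw cu cx cv hx !eqxx; move: lx; rewrite lv => -[<-]; rewrite eqxx.
case/same_stripP => u [v [lu lv cu cv huv]]; have [hc hd _] := boxE u.
by have := depth_le size_ab (col u); lia.
Qed.

Lemma conf_depth p : (conf_profile P p <= depth p) && (conf_profile P p <= depth p.+1).
Proof.
case E : (conf_profile P p) => [//|k].
have : same_strip P k p by rewrite -conf_profileE E.
case/same_stripP => u [v [lu lv cu cv _]].
by have [_ + _] := boxE u; have [_ + _] := boxE v; rewrite lu lv cu cv => -> ->.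
Qed.

Lemma conf_span : spanned m b (conf_profile P).
Proof.
move=> p k; rewrite conf_profileE => /same_stripP[u [v [lu lv cu cv huv]]].
have [hD hu] := conf_pblock u; have [x [y [k' [hr ED hv]]]] := conf_run hD.
have Ek : k' = k by move: hu; rewrite ED inE lu => /andP[/eqP].
subst k'.
have xp : x <= p < y.
  by move: hu huv; rewrite ED !inE cu cv; lia.
have [e [ee h1 h2 h3]] := valid_cover hv xp.
exists e; split => //; first lia.
move=> q hq; rewrite conf_profileE; apply: (same_strip_run (x := x) (y := y)) => //; last lia.
by rewrite -ED.
Qed.

(** A strip is a run, so it covers the letters between any two of its boxes. Conversely, covered
    letters are crossed one at a time, each joining two neighbouring boxes of one strip. *)
Lemma conf_link u v : link (conf_profile P) u v = (v \in pblock P u).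
Proof.
have sym u' v' : (v' \in pblock P u') = (u' \in pblock P v').
  by rewrite -!eq_pblock ?conf_cover // eq_sym.
apply/linkP/idP => [[E H]|huv]; last first.
  have [hD hu] := conf_pblock u; have E := conf_layer hD hu huv; split => //.
  have [x [y [k [hr ED _]]]] := conf_run hD => p hp.
  have Ek : layer u = k by move: hu; rewrite ED inE => /andP[/eqP].
  rewrite conf_profileE Ek; apply: (same_strip_run (x := x) (y := y)) => //; first by rewrite -ED.
  by move: hu huv; rewrite ED !inE; lia.
wlog le_uv : u v E H / col u <= col v.
  move=> W; case: (leqP (col u) (col v)) => h1; first exact: W.
  rewrite sym; apply: W => //; last exact: ltnW.
  by move=> p hp; rewrite -E; apply: H; lia.
move: {2}(col v - col u) (leqnn (col v - col u)) => n.
elim: n v E H le_uv => [|n IH] v E H le_uv hn.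
  by rewrite -(@box_inj _ _ size_ab u v) //; [case: (conf_pblock u)|lia].
case: (ltngtP (col u) (col v)) => [lt_uv| |Ec]; [|lia|]; last first.
  by rewrite -(@box_inj _ _ size_ab u v) //; case: (conf_pblock u).
have := H (col v).-1 ltac:(lia); rewrite conf_profileE => /same_stripP[w [v' [lw lv cw cv hw]]].
have Ev : v' = v by apply: (box_inj size_ab); [lia|rewrite lv E].
subst v'; have hwu : w \in pblock P u.
  by apply: IH; [rewrite lw E|move=> p hp; apply: H; lia|lia|lia].
by rewrite -(same_pblock triv hwu).
Qed.

Lemma conf_layers : layers (conf_profile P) = P.
Proof.
rewrite -[RHS](equivalence_partition_pblock part).
apply: eq_imset => u; apply/setP => v.
by rewrite !inE conf_link.
Qed.

(** The layers of this profile give back [P], so [card_strips] counts strips of [P] itself and the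
    even part of rule Ib applies to them. *)
Lemma conf_profileP : profile (conf_profile P).
Proof.
split; [exact: conf_span|exact: conf_depth|].
apply: (even_full size_ab conf_depth conf_span m_gt0) => x x0 lx.
have [xN _ _] := longP _ m_gt0 _ lx.
have vx : valid b m x N by case/andP: lx.
have [l [l' [El Eh]]] := valid_shape vx.
rewrite -(card_strips size_ab conf_depth conf_span m_gt0 x0 lx (esym El) Eh) conf_layers.
set S := [set _ in _ | _].
(* Rule Ib is indexed by lengths below the number of boxes. A strip of the given length supplies
   that bound; without one the count is 0. *)
case: (set_0Vmem S) => [->|[D]]; first by rewrite cards0.
rewrite inE => /andP[hD hs].
have [x' [y' [k [hr ED _]]]] := conf_run hD.
have := runnable_bound size_ab hr; rewrite ED in hs.
have [Ey' _] := ballot_strip_runE size_ab hr hs => hb.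
have hl : l < #|` R| by lia.
have hl' : l' < #|` R| by lia.
have /andP[ml ol] := long_strip m_gt0 lx (esym El) Eh.
case/and5P: conf => _ _ _ _ /forallP/(_ (Ordinal hl, Ordinal hl'))/implyP/(_ ml) /=.
by rewrite (negbTE ol).
Qed.

End Conf.

Lemma layers_profile c p : profile c -> conf_profile (layers c) p = c p.
Proof.
move=> pc; have pcf := layers_conf size_ab m_gt0 pc.
have H k : (k < conf_profile (layers c) p) = (k < c p).
  rewrite (conf_profileE pcf); apply/idP/idP => [/same_stripP[u [v [lu _ cu cv]]]|hk].
    by rewrite pblock_layers => /linkP[_ /(_ p)]; rewrite lu cu cv; apply; lia.
  have /andP[d1 d2] := profile_depth pc p.
  have [e [ee he _]] := profile_span pc hk; have [e1 _ _ _] := endpP ee.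
  have [u [cu lu]] := box_ex size_ab (ltac:(lia) : p <= N) (leq_trans hk d1).
  have [v [cv lv]] := box_ex size_ab (ltac:(lia) : p.+1 <= N) (leq_trans hk d2).
  apply/existsP; exists u; apply/existsP; exists v.
  rewrite lu lv cu cv !eqxx pblock_layers /=; apply/linkP; split; first by rewrite lu lv.
  by move=> q; rewrite lu cu cv => hq; have -> : q = p by lia.
apply/eqP; rewrite eqn_leq; apply/andP; split; rewrite leqNgt.
  by rewrite H ltnn.
by rewrite -H ltnn.
Qed.

(** Labellings and configurations correspond through profiles: [layers] after [label_profile] in one
    direction, [profile_labels] after [conf_profile] in the other. The exponents agree by
    [layers_weight]. *)
Lemma QBI_RB : QBI m a b = RB m a b.
Proof.
rewrite /QBI /RB.
rewrite (reindex_onto (fun nu : labels m a b => layers (label_profile nu))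
                      (fun P => profile_labels m a b (conf_profile P))) /=; last first.
  move=> P hP; rewrite -[RHS](conf_layers hP); apply: eq_layers => p.
  exact: profile_labelsK (conf_profileP hP).
apply: eq_big => [nu|nu /andP[hc /eqP E]].
  apply/andP/idP => [[hc /eqP <-]|lab].
    by apply: profile_labelling => //; exact: conf_profileP hc.
  have pn := label_profileP m_gt0 size_ab lab.
  split; first exact: layers_conf.
  rewrite -[X in _ == X](label_profileK m_gt0 size_ab lab); apply/eqP/ffunP => e.
  by rewrite !ffunE layers_profile.
have lab : labelling nu.
  by rewrite -E; apply: profile_labelling => //; exact: conf_profileP hc.
rewrite prodrXr (layers_weight size_ab m_gt0 (label_profileP m_gt0 size_ab lab)).
congr ('X ^+ (2 * _))%R; apply: eq_bigr => e _.
exact: label_profile_edge.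
Qed.

End FromConf.

Theorem theorem30 (m N : nat) (a b : N.-tuple bool) :
  0 < m -> string_le a b -> QBI m a b = RB m a b.
Proof. by move=> m_gt0 _; apply: QBI_RB; rewrite // !size_tuple. Qed.
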